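(* For any $\underline{f}\in F$, $$\lim_{\varepsilon\to 0}\ \lim_{T\to\infty}\ \frac{1}{T^2}\ln \mathbf{P}\bigl(\xi_T\in U_\varepsilon(\underline{f})\bigr)=-I(\underline{f}),$$ where $U_\varepsilon(\underline f)=\{\underline g\in X:\ d(\underline f,\underline g)<\varepsilon\}$.
   Context: Let $\mathbb{Z}^2_+=\{(z_1,z_2)\in\mathbb{Z}^2: z_1\ge 0, z_2\ge 0\}$ and $\mathcal{Y}=\{(1,0),(0,1),(-1,0),(0,-1),(-1,-1)\}$. Fix positive constants $\lambda(\underline y)$, $\underline y\in\mathcal{Y}$. Let $\xi(t)=(\xi_1(t),\xi_2(t))$, $t\ge 0$, be the continuous-time Markov jump process on $\mathbb{Z}^2_+$ with $\xi(0)=(0,0)$ which jumps from $\underline z=(z_1,z_2)$ to $\underline z+\underline y$, $\underline y\in\mathcal{Y}$, with intensity $\lambda_{\underline z}(\underline y)$, where $$\lambda_{\underline z}(1,0)=\lambda(1,0),\quad \lambda_{\underline z}(0,1)=\lambda(0,1),\quad \lambda_{\underline z}(-1,0)=z_1\lambda(-1,0),\quad \lambda_{\underline z}(0,-1)=z_2\lambda(0,-1),$$ $$\lambda_{\underline z}(-1,-1)=\min\{z_1,z_2\}\lambda(-1,-1).$$ That is, the process stays in $\underline z$ for an exponential time with parameter $h(\underline z)=\sum_{\underline y\in\mathcal{Y}}\lambda_{\underline z}(\underline y)$ and then jumps by $\underline y$ with probability $\lambda_{\underline z}(\underline y)/h(\underline z)$. Put $c_1=\lambda(-1,0)$, $c_2=\lambda(0,-1)$,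 $c_3=\lambda(-1,-1)$. For $T>0$ the scaled process is $\xi_T(t)=\frac1T\xi(tT)$, $t\in[0,1]$. $X$ is the set of càdlàg functions $\underline x:[0,1]\to\mathbb{R}^2_+=\{(y_1,y_2)\in\mathbb{R}^2: y_1\ge0,y_2\ge0\}$ (right-continuous with left limits everywhere) having a finite number of jumps on $[0,1]$ and satisfying $\underline x(0)=(0,0)$, with the uniform distance $d(\underline x_1,\underline x_2)=\sup_{t\in[0,1]}\|\underline x_1(t)-\underline x_2(t)\|$, where $\|\cdot\|$ is the Euclidean norm on $\mathbb{R}^2$. $F\subset X$ is the set of continuous functions $\underline f=(f_1,f_2)$ on $[0,1]$ with $\underline f(0)=(0,0)$ and $f_1(t)>0$, $f_2(t)>0$ for all $t>0$. The functional $I:X\to\mathbb{R}\cup\{\infty\}$ is defined by $$I(\underline x)=\int_0^1\bigl(c_1x_1(t)+c_2x_2(t)+c_3\min\{x_1(t),x_2(t)\}\bigr)\,dt\ \text{ if }\underline x\in F,\qquad I(\underline x)=\infty\ \text{ if }\underline x\notin F.$$ *)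

(* Defs.v *)
From HB Require Import structures.
From mathcomp Require Import all_boot all_order all_algebra.
From mathcomp Require Import all_classical all_reals all_analysis.
Set Implicit Arguments.
Unset Strict Implicit.
Unset Printing Implicit Defensive.
Import Order.TTheory GRing.Theory Num.Theory.
Import numFieldNormedType.Exports.
Local Open Scope classical_set_scope.
Local Open Scope ring_scope.

(* A state (z_1, z_2) with z_1, z_2 >= 0 is a pair of naturals. *)
Definition state : Type := (nat * nat)%type.

Definition step : Type := (int * int)%type.

Definition steps : seq step := [:: (1, 0); (0, 1); (-1, 0); (0, -1); (-1, -1)].

Section JumpProcess.
Context {R : realType}.
Variable lambda : step -> R.

Definition rate (z : state) (y : step) : R :=
  if (y == (1, 0)) || (y == (0, 1)) then lambda y
  else if y == (-1, 0) then z.1%:R * lambda y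
  else if y == (0, -1) then z.2%:R * lambda y
  else if y == (-1, -1) then (minn z.1 z.2)%:R * lambda y
  else 0.

Definition total_rate (z : state) : R := \sum_(y <- steps) rate z y.

Definition jump_prob (z z' : state) : R :=
  rate z (z'.1%:Z - z.1%:Z, z'.2%:Z - z.2%:Z) / total_rate z.

(* [Z n] is the n-th visited state and [tau n] the time spent there, so that
   the n-th jump occurs at time [\sum_(i < n) tau i].  The product formula says
   that, conditionally on the past, the time spent in z is exponential with
   parameter [total_rate z] and that the next state is then drawn,
   independently of that time, according to [jump_prob z].
   These rates make the process non-explosive almost surely; here the jump
   times tend to infinity on every outcome, so that every trajectory is a
   right-continuous step function defined for all t >= 0. *)
Definition markov_jump_process d (Omega : measurableType d)
    (P : probability Omega R) (xi : R -> Omega -> state) : Prop :=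
  exists (Z : nat -> {RV P >-> state}) (tau : nat -> {RV P >-> R}),
  [/\ forall w, Z 0%N w = (0%N, 0%N),
      forall n w, 0 < tau n w,
      forall w (t : R), exists n, t < \sum_(i < n) tau i w,
      forall n w (t : R), \sum_(i < n) tau i w <= t < \sum_(i < n.+1) tau i w ->
        xi t w = Z n w
    & forall (n : nat) (z : nat -> state) (B : nat -> set R),
        z 0%N = (0%N, 0%N) -> (forall i, measurable (B i)) ->
        P [set w | forall i, (i < n)%N ->
                     B i (tau i w) /\ Z i.+1 w = z i.+1] =
        (\prod_(i < n) (exponential_prob (total_rate (z i)) (B i) *
                        (jump_prob (z i) (z i.+1))%:E))%E].

Definition scaled_process (Omega : Type) (xi : R -> Omega -> state) (T : R)
    (w : Omega) (t : R) : R * R :=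
  (T^-1 * (xi (t * T) w).1%:R, T^-1 * (xi (t * T) w).2%:R).

End JumpProcess.

Section PathSpace.
Context {R : realType}.

(* The library's norm on R * R is the maximum norm. *)
Definition euclidean_norm (v : R * R) : R := Num.sqrt (v.1 ^+ 2 + v.2 ^+ 2).

(* Paths are total functions on R of which only the restriction to [0, 1]
   is ever considered. *)
Definition trajectory : Type := R -> R * R.

Definition cadlag (x : trajectory) : Prop :=
  (forall t : R, 0 <= t < 1 -> x s @[s --> t^'+] --> x t) /\
  (forall t : R, 0 < t <= 1 -> exists l : R * R, x s @[s --> t^'-] --> l).

Definition jump_times (x : trajectory) : set R :=
  [set t | 0 < t <= 1 /\ ~ (x s @[s --> t^'-] --> x t)].

Definition X_space : set trajectory :=
  [set x | [/\ forall t : R, 0 <= t <= 1 -> 0 <= (x t).1 /\ 0 <= (x t).2,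
               cadlag x, finite_set (jump_times x) & x 0 = (0, 0)]].

Definition uniform_dist (x1 x2 : trajectory) : \bar R :=
  ereal_sup [set (euclidean_norm (x1 t - x2 t))%:E | t in `[0, 1]].

Definition F_space : set trajectory :=
  [set f | [/\ X_space f, {within `[0, 1], continuous f}
             & forall t : R, 0 < t <= 1 -> 0 < (f t).1 /\ 0 < (f t).2]].

Definition U_ball (eps : R) (f : trajectory) : set trajectory :=
  [set g | X_space g /\ (uniform_dist f g < eps%:E)%E].

Definition rate_functional (lambda : step -> R) (x : trajectory) : \bar R :=
  if `[< F_space x >] then
    (\int[lebesgue_measure]_(t in `[0%R, 1%R])
       (lambda (-1, 0) * (x t).1 + lambda (0, -1) * (x t).2
        + lambda (-1, -1) * Num.min (x t).1 (x t).2)%R%:E)%E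
  else +oo%E.

End PathSpace.

Arguments trajectory : clear implicits.

(* [lne] is the extended logarithm, with [lne 0 = -oo]. *)
Definition scaled_log_prob {R : realType} d (Omega : measurableType d)
    (P : probability Omega R) (xi : R -> Omega -> state) (f : trajectory R)
    (eps T : R) : \bar R :=
  ((T ^- 2)%:E * lne (P [set w | U_ball eps f (scaled_process xi T w)]))%E.

(* Main.v *)
Require Import Defs.
From HB Require Import structures.
From mathcomp Require Import all_boot all_order all_algebra.
From mathcomp Require Import all_classical all_reals all_analysis.
From mathcomp Require Import measurable_realfun.
From mathcomp Require Import zify ring lra.
Set Implicit Arguments.
Unset Strict Implicit.
Unset Printing Implicit Defensive.
Import Order.TTheory GRing.Theory Num.Theory.
Import numFieldNormedType.Exports.
Local Open Scope classical_set_scope.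
Local Open Scope ring_scope.

(** To follow a prescribed trajectory of size [T] during a time [T], order [T] jumps
    are enough. Making them at prescribed places and at roughly prescribed times costs a
    factor [expR (- O(T))], which is invisible on the scale of [T ^+ 2]. What remains
    is the price of not jumping. In the state [z] it is [total_rate z] per unit of
    time, that is [up_rate] plus the downward intensity [cost (real_point z)], which
    is homogeneous of degree one (total_rateE). For a trajectory with rescaling [g]
    the exponent is therefore [T ^+ 2] times the integral of [cost (g t)].

    For a fixed radius the process can sit, at each time, at the cheapest point of
    the ball about the centre, and it can jump from one such point to another at
    no cost. So the limit in [T] is [- tube_cost eps], where [tube_cost eps] is the
    integral of [min_cost eps (f t)]. As [cost] is Lipschitz, [tube_cost eps] is within
    [cost_lip * eps] of the integral of [cost (f t)], which gives the limit in [eps].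

    Upper bound (tube_prob_le). On the event, [T ^+ 2 * tube_cost eps] is at most the
    sum of [cost * tau] over the sojourns (tube_cost_le), and Chebyshev's inequality
    is applied to the exponential of that sum. Along one path the exponential
    tilts each sojourn from the rate [total_rate] to the rate [up_rate]
    (cylinder_moment, chernoff_path), which leaves a product of transition rates to be
    summed over all paths. The sum would be of order [expR (O(T ^+ 2))], because the
    downward rates are of order [T]; but there cannot be more jumps down than up,
    which is expressed by giving the state the weight [a ^+ level]: downward rates are
    divided by [a] and upward ones multiplied by [a] (sum_path_weight). The exponent
    becomes [O(a * T + T ^+ 2 / a)], and [a] is taken large.

    Lower bound (tube_prob_ge). The unit interval is cut into slots. In each of them a
    plan prescribes a walk to a nearly cheapest lattice point and a wait there
    (slots_plan). Asking each sojourn time to be within a fixed [delta] of its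
    prescribed value has a probability bounded below by the exponential of the
    integrated total rate, up to a factor [rho * delta] per jump (cylinder_lower). *)

(** * The Euclidean norm *)

Section EuclideanNorm.
Context {R : realType}.
Implicit Types u v : R * R.

Lemma euclidean_norm_ge0 u : 0 <= euclidean_norm u.
Proof. exact: sqrtr_ge0. Qed.

Lemma ler_normr1 u : `|u.1| <= euclidean_norm u.
Proof. by rewrite -sqrtr_sqr ler_sqrt ?addr_ge0 ?sqr_ge0// lerDl sqr_ge0. Qed.

Lemma ler_normr2 u : `|u.2| <= euclidean_norm u.
Proof. by rewrite -sqrtr_sqr ler_sqrt ?addr_ge0 ?sqr_ge0// lerDr sqr_ge0. Qed.

Lemma euclidean_norm_le_add u : euclidean_norm u <= `|u.1| + `|u.2|.
Proof.
rewrite -[leRHS]ger0_norm ?addr_ge0// -sqrtr_sqr ler_sqrt ?sqr_ge0//.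
rewrite -(real_normK (num_real u.1)) -(real_normK (num_real u.2)).
have := normr_ge0 u.1; have := normr_ge0 u.2; nra.
Qed.

Lemma euclidean_norm_homo u v :
  `|u.1| <= `|v.1| -> `|u.2| <= `|v.2| -> euclidean_norm u <= euclidean_norm v.
Proof.
move=> h1 h2; rewrite ler_sqrt ?addr_ge0 ?sqr_ge0//.
have sqr_le (a b : R) : `|a| <= `|b| -> a ^+ 2 <= b ^+ 2.
  by move=> ab; rewrite -(real_normK (num_real a)) -(real_normK (num_real b)) lerXn2r// nnegrE.
by rewrite lerD// sqr_le.
Qed.

Lemma euclidean_norm_distC u v : euclidean_norm (u - v) = euclidean_norm (v - u).
Proof. by rewrite /euclidean_norm /=; congr Num.sqrt; ring. Qed.

Lemma euclidean_norm_scale (a : R) u v : 0 <= a -> v.1 = a * u.1 -> v.2 = a * u.2 ->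
  euclidean_norm v = a * euclidean_norm u.
Proof.
move=> a0 h1 h2; rewrite /euclidean_norm h1 h2 !exprMn -mulrDr sqrtrM ?sqr_ge0//.
by rewrite sqrtr_sqr ger0_norm.
Qed.

(** Cauchy-Schwarz, by Lagrange's identity. *)
Lemma euclidean_normD u v :
  euclidean_norm (u + v) <= euclidean_norm u + euclidean_norm v.
Proof.
have un := euclidean_norm_ge0 u; have vn := euclidean_norm_ge0 v.
rewrite -[leRHS]ger0_norm ?addr_ge0// -sqrtr_sqr ler_sqrt ?sqr_ge0//.
have uE : euclidean_norm u ^+ 2 = u.1 ^+ 2 + u.2 ^+ 2.
  by rewrite sqr_sqrtr// addr_ge0 ?sqr_ge0.
have vE : euclidean_norm v ^+ 2 = v.1 ^+ 2 + v.2 ^+ 2.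
  by rewrite sqr_sqrtr// addr_ge0 ?sqr_ge0.
rewrite [in leRHS]sqrrD uE vE /=.
suff : u.1 * v.1 + u.2 * v.2 <= euclidean_norm u * euclidean_norm v by nra.
rewrite -[leRHS]ger0_norm ?mulr_ge0// -sqrtr_sqr exprMn uE vE.
apply: le_trans (ler_norm _) _; rewrite -sqrtr_sqr ler_sqrt; last first.
  by rewrite mulr_ge0 ?addr_ge0 ?sqr_ge0.
rewrite -subr_ge0; set D := (X in 0 <= X).
have -> : D = (u.1 * v.2 - u.2 * v.1) ^+ 2 by rewrite /D; ring.
exact: sqr_ge0.
Qed.

Lemma euclidean_norm_dist u v w :
  euclidean_norm (u - w) <= euclidean_norm (u - v) + euclidean_norm (v - w).
Proof.
apply: le_trans (euclidean_normD _ _); rewrite (_ : u - v + (v - w) = u - w)//.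
by rewrite addrA subrK.
Qed.

End EuclideanNorm.

(** * The running cost and its infimum over a ball *)

Section Cost.
Context {R : realType}.
Variable lambda : step -> R.
Hypothesis lambda_gt0 : forall y, y \in steps -> 0 < lambda y.
Implicit Types (p q y : R * R) (eps e : R).

Definition cost p : R :=
  lambda (-1, 0) * p.1 + lambda (0, -1) * p.2
  + lambda (-1, -1) * Num.min p.1 p.2.

Definition cost_lip : R :=
  lambda (-1, 0) + lambda (0, -1) + lambda (-1, -1).

Definition quadrant p : Prop := 0 <= p.1 /\ 0 <= p.2.

Lemma lambda_left_gt0 : 0 < lambda (-1, 0). Proof. exact: lambda_gt0. Qed.
Lemma lambda_down_gt0 : 0 < lambda (0, -1). Proof. exact: lambda_gt0. Qed.
Lemma lambda_diag_gt0 : 0 < lambda (-1, -1). Proof. exact: lambda_gt0. Qed.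
Lemma lambda_right_gt0 : 0 < lambda (1, 0). Proof. exact: lambda_gt0. Qed.
Lemma lambda_up_gt0 : 0 < lambda (0, 1). Proof. exact: lambda_gt0. Qed.

Let c1 := lambda_left_gt0.
Let c2 := lambda_down_gt0.
Let c3 := lambda_diag_gt0.

Lemma cost_lip_gt0 : 0 < cost_lip.
Proof. by rewrite /cost_lip !addr_gt0. Qed.

Lemma cost_ge0 p : quadrant p -> 0 <= cost p.
Proof.
by move=> [p1 p2]; rewrite /cost !addr_ge0 ?mulr_ge0 ?(ltW c1) ?(ltW c2) ?(ltW c3)// le_min p1.
Qed.

(** All three coefficients are positive, so [cost] is monotone, and a common
    increase of both coordinates by [e] raises it by [cost_lip * e]. *)
Lemma cost_le p q e : p.1 <= q.1 + e -> p.2 <= q.2 + e ->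
  cost p <= cost q + cost_lip * e.
Proof.
move=> h1 h2; rewrite /cost /cost_lip.
have h3 : Num.min p.1 p.2 <= Num.min q.1 q.2 + e.
  by rewrite ge_min; case: (leP q.1 q.2) => _; rewrite ?h1 ?h2 ?orbT.
have := ler_wpM2l (ltW c1) h1; have := ler_wpM2l (ltW c2) h2.
have := ler_wpM2l (ltW c3) h3; lra.
Qed.

Lemma cost_homo p q : p.1 <= q.1 -> p.2 <= q.2 -> cost p <= cost q.
Proof.
by move=> h1 h2; have := @cost_le p q 0; rewrite mulr0 !addr0; apply.
Qed.

Lemma cost_scale (a : R) p : 0 <= a -> cost (a * p.1, a * p.2) = a * cost p.
Proof. by move=> a0; rewrite /cost /= -minr_pMr//; ring. Qed.

Lemma cost_dist p q : cost p <= cost q + cost_lip * euclidean_norm (p - q).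
Proof.
have /= h1 := ler_normr1 (p - q); have /= h2 := ler_normr2 (p - q).
apply: cost_le; rewrite -lerBlDl; first exact: le_trans (ler_norm _) h1.
exact: le_trans (ler_norm _) h2.
Qed.

(** What a trajectory of the tube of radius [eps] has to pay per unit of time, at
    the least, while the centre of the tube is at [p]. *)
Definition min_cost eps p : R :=
  inf [set cost y | y in [set y | quadrant y /\ euclidean_norm (y - p) < eps]].

Lemma min_cost_le eps p y : quadrant y -> euclidean_norm (y - p) < eps ->
  min_cost eps p <= cost y.
Proof.
move=> y0 yp; apply: ge_inf; last by exists y.
by exists 0 => _ [z [z0 _] <-]; exact: cost_ge0.
Qed.

Lemma euclidean_norm_subrr p : euclidean_norm (p - p) = 0 :> R.
Proof. by rewrite subrr /euclidean_norm /= expr0n addr0 sqrtr0. Qed.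

Lemma min_cost_approx eps p e : 0 < eps -> quadrant p -> 0 < e ->
  exists y, [/\ quadrant y, euclidean_norm (y - p) < eps &
    cost y < min_cost eps p + e].
Proof.
move=> eps0 p0 e0.
pose A := [set cost y | y in [set y | quadrant y /\ euclidean_norm (y - p) < eps]].
have /(inf_adherent e0) : has_inf A.
  split; first by exists (cost p), p => //; split => //; rewrite euclidean_norm_subrr.
  by exists 0 => _ [z [z0 _] <-]; exact: cost_ge0.
by move=> [_ [y [y0 yp] <-] yA]; exists y; split.
Qed.

Lemma min_cost_le_cost eps p : 0 < eps -> quadrant p -> min_cost eps p <= cost p.
Proof. by move=> e0 p0; apply: min_cost_le => //; rewrite euclidean_norm_subrr. Qed.

Lemma min_cost_ge_cost eps p : 0 < eps -> quadrant p ->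
  cost p - cost_lip * eps <= min_cost eps p.
Proof.
move=> eps0 p0; apply/ler_addgt0Pr => e e0.
have [y [y0 yp /ltW ycost]] := min_cost_approx eps0 p0 e0.
apply: le_trans _ ycost; rewrite lerBlDr.
apply: le_trans (cost_dist p y) _; rewrite lerD2l ler_pM2l ?cost_lip_gt0//.
by rewrite euclidean_norm_distC ltW.
Qed.

Lemma min_cost_ge0 eps p : 0 < eps -> quadrant p -> 0 <= min_cost eps p.
Proof.
move=> eps0 p0; apply/ler_addgt0Pr => e e0.
have [y [y0 yp /ltW ycost]] := min_cost_approx eps0 p0 e0.
exact: le_trans (cost_ge0 y0) ycost.
Qed.

(** Translating a cheap point along with the centre may push it out of the
    quadrant. The projection onto the quadrant fixes the new centre and does not
    increase distances to it, so it brings the point back into the new ball. *)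
Lemma min_cost_dist eps p q : 0 < eps -> quadrant p -> quadrant q ->
  min_cost eps q <= min_cost eps p + cost_lip * euclidean_norm (q - p).
Proof.
move=> eps0 p0 q0; apply/ler_addgt0Pr => e e0.
have [y [[y1 y2] yp /ltW ycost]] := min_cost_approx eps0 p0 e0.
rewrite addrAC; apply: le_trans _ (lerD ycost (lexx _)).
pose y' : R * R := (Num.max (y.1 + (q.1 - p.1)) 0, Num.max (y.2 + (q.2 - p.2)) 0).
have proj (a b c : R) : 0 <= b -> 0 <= c -> `|Num.max (a + (b - c)) 0 - b| <= `|a - c|.
  move=> b0 c0; case: (lerP (a + (b - c)) 0) => h.
    rewrite sub0r normrN (ger0_norm b0) ler_normr; apply/orP; right; lra.
  by rewrite (_ : a + (b - c) - b = a - c)//; ring.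
apply: (@le_trans _ _ (cost y')).
  apply: min_cost_le; first by split => /=; rewrite le_max lexx orbT.
  by apply: le_lt_trans yp; apply: euclidean_norm_homo; apply: proj; [case: q0|case: p0|case: q0|case: p0].
have /= h1 := ler_normr1 (q - p); have /= h2 := ler_normr2 (q - p).
have en0 := euclidean_norm_ge0 (q - p).
apply: cost_le => /=; rewrite ge_max; apply/andP; split.
- by rewrite lerD2l; exact: le_trans (ler_norm _) h1.
- by rewrite addr_ge0.
- by rewrite lerD2l; exact: le_trans (ler_norm _) h2.
- by rewrite addr_ge0.
Qed.

(** Contracting the ball towards its centre moves a nearly cheapest point by at
    most [e]. The margin gained is spent later on rounding to the lattice and on
    the variation of the centre. *)
Lemma min_cost_inner eps e p : 0 < e -> e <= eps -> quadrant p ->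
  exists y, [/\ quadrant y, euclidean_norm (y - p) <= eps - e &
    cost y <= min_cost eps p + (cost_lip + 1) * e].
Proof.
move=> e0 e_eps p0; have eps0 := lt_le_trans e0 e_eps.
have [y [[y1 y2] yp /ltW ycost]] := min_cost_approx eps0 p0 e0.
case: p0 => p1 p2.
pose s := e / eps.
have s0 : 0 <= s by rewrite divr_ge0// ltW.
have s1 : s <= 1 by rewrite ler_pdivrMr ?mul1r.
pose y' : R * R := ((1 - s) * y.1 + s * p.1, (1 - s) * y.2 + s * p.2).
have s1' : 0 <= 1 - s by rewrite subr_ge0.
exists y'; split.
- by split => /=; rewrite addr_ge0// mulr_ge0.
- rewrite (@euclidean_norm_scale _ (1 - s) (y - p))//=; [|ring|ring].
  apply: (@le_trans _ _ ((1 - s) * eps)); first by rewrite ler_wpM2l// ltW.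
  by rewrite mulrBl mul1r /s divfK// gt_eqF.
- apply: le_trans (cost_dist _ y) _.
  suff : cost_lip * euclidean_norm (y' - y) <= cost_lip * e by lra.
  rewrite ler_pM2l ?cost_lip_gt0// euclidean_norm_distC.
  rewrite (@euclidean_norm_scale _ s (y - p))//=; [|ring|ring].
  apply: (@le_trans _ _ (s * eps)); first by rewrite ler_wpM2l// ltW.
  by rewrite /s divfK// gt_eqF.
Qed.

End Cost.

(** * Continuous paths and integrals along them *)

Section UniformContinuity.
Context {R : realType}.
Variable f : trajectory R.
Hypothesis cf : {within `[0, 1], continuous f}.

Lemma near_dist (x r : R) : 0 < r -> \forall y \near x, `|y - x| < r.
Proof.
move=> r0; near=> y; rewrite distrC; near: y; exact: nbhsx_ballx.
Unshelve. all: by end_near. Qed.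

Lemma within_continuous_norm (x e : R) : 0 <= x <= 1 -> 0 < e ->
  exists2 r : R, 0 < r & forall y : R, 0 <= y <= 1 -> `|y - x| < r ->
    euclidean_norm (f y - f x) <= e.
Proof.
move=> x01 e0.
have /subspace_continuousP/(_ x) := cf.
rewrite /= in_itv /= => /(_ x01)/cvgrPdist_le/(_ (e / 2)).
rewrite divr_gt0// => /(_ isT); rewrite near_withinE.
move=> /nbhs_ballP[r /= r0 rP]; exists r => // y y01 yr.
have /(_ y) := rP; rewrite /ball /= distrC => /(_ yr).
rewrite in_itv /= => /(_ y01).
rewrite prod_normE ge_max /= => /andP[h1 h2].
rewrite euclidean_norm_distC; apply: le_trans (euclidean_norm_le_add _) _ => /=.
by rewrite [leRHS](splitr e) lerD.
Qed.

(** Heine-Cantor, from the near-covering form of compactness. *)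
Lemma uniform_modulus (e : R) : 0 < e ->
  exists2 r : R, 0 < r & forall x y, 0 <= x <= 1 -> 0 <= y <= 1 ->
    `|y - x| < r -> euclidean_norm (f y - f x) <= e.
Proof.
move=> e0.
pose P (r x : R) := forall y : R, 0 <= y <= 1 -> `|y - x| < r ->
    euclidean_norm (f y - f x) <= e.
have : \forall r \near 0^'+, `[0, 1]%classic `<=` P r.
  have /compact_near_coveringP/near_covering_withinP := @segment_compact R 0 1.
  apply => /= x; rewrite in_itv /= => x01.
  have [|r r0 rP] := @within_continuous_norm x (e / 2) x01; first by rewrite divr_gt0.
  near=> x' i => /=; rewrite in_itv /= => x'01 y y01 yx'.
  rewrite [leRHS](splitr e).
  apply: le_trans (euclidean_norm_dist _ (f x) _) _; apply: lerD.
    apply: rP => //; rewrite (splitr r).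
    rewrite (_ : y - x = (y - x') + (x' - x)); last by ring.
    apply: le_lt_trans (ler_normD _ _) _; apply: ltrD.
      apply: lt_le_trans yx' _; apply: ltW.
      by near: i; apply: nbhs_right_lt; rewrite divr_gt0.
    by near: x'; apply: near_dist; rewrite divr_gt0.
  rewrite euclidean_norm_distC; apply: rP => //; near: x'; exact: near_dist.
move=> H; near (0 : R)^'+ => r.
exists r => // x y x01 y01 xy.
suff /(_ x) : `[0, 1]%classic `<=` P r.
  by rewrite /= in_itv /= => /(_ x01); exact.
by near: r.
Unshelve. all: by end_near. Qed.

Lemma within_continuous_lip (g : R -> R) (C : R) : 0 < C ->
  (forall x y, 0 <= x <= 1 -> 0 <= y <= 1 ->
     g x <= g y + C * euclidean_norm (f x - f y)) ->
  {within `[0, 1], continuous g}.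
Proof.
move=> C0 gC; apply/subspace_continuousP => x /=; rewrite in_itv /= => x01.
apply/cvgrPdist_le => e e0; rewrite near_withinE.
have [|r r0 rP] := @within_continuous_norm x (e / C) x01; first by rewrite divr_gt0.
apply: filterS (near_dist x r0) => y yr; rewrite /= in_itv /= => y01.
have := rP y y01 yr; rewrite ler_pdivlMr// mulrC => h.
have := gC _ _ x01 y01; have := gC _ _ y01 x01; rewrite (euclidean_norm_distC (f x)).
by rewrite /from_subspace ler_distlC => h1 h2; apply/andP; split; lra.
Qed.

End UniformContinuity.

Section UnitIntegral.
Context {R : realType}.
Notation mu := (@lebesgue_measure R).
Variable g : R -> R.
Hypothesis cg : {within `[0, 1], continuous g}.

Definition path_integral (a b : R) : R := (\int[mu]_(t in `[a, b]) g t)%R.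

Lemma integrable_unit (a b : R) : 0 <= a -> b <= 1 ->
  mu.-integrable `[a, b] (EFin \o g).
Proof.
move=> a0 b1; apply: continuous_compact_integrable; first exact: segment_compact.
apply: continuous_subspaceW cg => x /=; rewrite !in_itv /= => /andP[h1 h2].
by rewrite (le_trans a0)//= (le_trans h2).
Qed.

Lemma path_integralD (a b c : R) : 0 <= a -> a <= b -> b <= c -> c <= 1 ->
  path_integral a c = path_integral a b + path_integral b c.
Proof.
move=> a0 ab bc c1; rewrite /path_integral.
have := @Rintegral_itvB R g (BLeft a) (BRight c) b (integrable_unit a0 c1).
rewrite !bnd_simp => /(_ ab bc) /eqP; rewrite subr_eq => /eqP ->.
rewrite addrC; congr (_ + _).
rewrite Rintegral_itv_obnd_cbnd//.
apply: integrableS (integrable_unit (le_trans a0 ab) c1) => //.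
by apply: subset_itv; rewrite bnd_simp.
Qed.

Lemma lebesgue_segment (a b : R) : a <= b -> fine (mu `[a, b]) = b - a.
Proof.
move=> ab; rewrite lebesgue_measure_itv /= lte_fin; case: ltP => //= ba.
by apply/esym/eqP; rewrite subr_eq0 eq_le ba ab.
Qed.

Lemma integrable_cst_segment (a b C : R) : mu.-integrable `[a, b] (EFin \o cst C).
Proof.
apply: continuous_compact_integrable; first exact: segment_compact.
by apply: continuous_subspaceT => x; exact: cvg_cst.
Qed.

(** The bound is asked for on a half-open interval because sojourns of the process
    are half-open. *)
Lemma path_integral_le (a b C : R) : 0 <= a -> a <= b -> b <= 1 ->
  (forall t, a <= t < b -> g t <= C) -> path_integral a b <= C * (b - a).
Proof.
move=> a0 ab b1 gC.
have intg : mu.-integrable `[a, b[ (EFin \o g).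
  apply: integrableS (integrable_unit a0 b1) => //.
  by apply: subset_itv; rewrite bnd_simp.
rewrite /path_integral -Rintegral_itv_bndo_bndc//.
have intC : mu.-integrable `[a, b[ (EFin \o cst C).
  apply: integrableS (integrable_cst_segment a b C) => //.
  by apply: subset_itv; rewrite bnd_simp.
apply: le_trans (le_Rintegral _ intg intC _) _ => //.
rewrite Rintegral_itv_bndo_bndc// Rintegral_cst// lebesgue_segment//.
Qed.

Lemma path_integral_ge (a b C : R) : 0 <= a -> a <= b -> b <= 1 ->
  (forall t, a <= t <= b -> C <= g t) -> C * (b - a) <= path_integral a b.
Proof.
move=> a0 ab b1 gC.
have intC := integrable_cst_segment a b C.
rewrite -(lebesgue_segment ab) -Rintegral_cst//.
by apply: le_Rintegral intC (integrable_unit a0 b1) _.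
Qed.

End UnitIntegral.

(** * Step paths *)

Section SteppedPath.
Context {R : realType}.
Variables (Z : nat -> state) (tau : nat -> R) (x : R -> state) (T : R).
Hypothesis T_gt0 : 0 < T.
Hypothesis tau_gt0 : forall n, 0 < tau n.
Hypothesis tau_unbounded : forall t : R, exists n, t < \sum_(i < n) tau i.
Hypothesis xE : forall n (t : R),
  \sum_(i < n) tau i <= t < \sum_(i < n.+1) tau i -> x t = Z n.

Local Notation S n := (\sum_(i < n) tau i).

Definition scaled_path (t : R) : R * R :=
  (T^-1 * (x (t * T)).1%:R, T^-1 * (x (t * T)).2%:R).

Lemma jump_time_lt n : S n < S n.+1.
Proof. by rewrite big_ord_recr /= ltrDl. Qed.

Lemma jump_time_homo m n : (m <= n)%N -> S m <= S n.
Proof.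
move=> /subnK <-; elim: (n - m)%N => // k IH.
by rewrite addSn; apply: le_trans IH (ltW (jump_time_lt _)).
Qed.

Lemma locate_right (t : R) : 0 <= t -> exists n, S n <= t < S n.+1.
Proof.
move=> t0; have ex := tau_unbounded t.
have [n tn nmin] := ex_minnP ex.
case: n tn nmin => [|n tn nmin].
  by rewrite big_ord0 ltNge t0.
exists n; rewrite tn andbT leNgt; apply/negP => /nmin.
by rewrite ltnn.
Qed.

(** The variant of [locate_right] that yields left limits. *)
Lemma locate_left (t : R) : 0 < t -> exists n, S n < t <= S n.+1.
Proof.
move=> t0; have [n /andP[]] := locate_right (ltW t0).
rewrite le_eqVlt => /predU1P[St|nt] tn; last by exists n; rewrite nt ltW.
case: n St tn => [|n] St tn; first by rewrite -St big_ord0 ltxx in t0.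
by exists n; rewrite -St lexx andbT jump_time_lt.
Qed.

Lemma scaled_pathE n (t : R) : S n <= t * T < S n.+1 ->
  scaled_path t = (T^-1 * (Z n).1%:R, T^-1 * (Z n).2%:R).
Proof. by move=> h; rewrite /scaled_path (xE h). Qed.

Lemma scaled_path_right (t : R) : 0 <= t ->
  exists2 r : R, 0 < r & forall s, t <= s < t + r -> scaled_path s = scaled_path t.
Proof.
move=> t0; have [n /andP[nt tn]] := locate_right (mulr_ge0 t0 (ltW T_gt0)).
exists (S n.+1 / T - t) => [|s /andP[ts sr]].
  by rewrite subr_gt0 ltr_pdivlMr.
rewrite (@scaled_pathE n t) ?nt// (@scaled_pathE n s)//; apply/andP; split.
  by rewrite (le_trans nt)// ler_pM2r.
by rewrite -ltr_pdivlMr//; move: sr; rewrite addrC subrK.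
Qed.

Lemma scaled_path_left n (t : R) : S n < t * T <= S n.+1 ->
  \forall s \near t^'-, scaled_path s = (T^-1 * (Z n).1%:R, T^-1 * (Z n).2%:R).
Proof.
move=> /andP[nt tn]; near=> s.
apply: scaled_pathE; apply/andP; split.
  rewrite -ler_pdivrMr//; near: s; apply: nbhs_left_ge.
  by rewrite ltr_pdivrMr.
apply: lt_le_trans tn; rewrite ltr_pM2r//; near: s; exact: nbhs_left_lt.
Unshelve. all: by end_near. Qed.

Lemma scaled_path_X_space : x 0 = (0%N, 0%N) -> X_space scaled_path.
Proof.
move=> x0; split.
- move=> t _; rewrite /scaled_path /=.
  by split; rewrite mulr_ge0 ?invr_ge0 ?(ltW T_gt0).
- split=> t /andP[t0 t1].
    have [r r0 rP] := scaled_path_right t0.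
    apply: cvg_near_cst; near=> s; apply: rP.
    apply/andP; split; near: s; first exact: nbhs_right_ge.
    by apply: nbhs_right_lt; rewrite ltrDl.
  have [n nt] := locate_left (mulr_gt0 t0 T_gt0).
  exists (T^-1 * (Z n).1%:R, T^-1 * (Z n).2%:R).
  by apply: cvg_near_cst; exact: scaled_path_left nt.
- have [N TN] := tau_unbounded T.
  apply: (@sub_finite_set _ _ ((fun n => S n / T) @` `I_N)).
    move=> t [/andP[t0 t1] tJ]; apply: contrapT => tS; apply: tJ.
    have [n /andP[nt tn]] := locate_left (mulr_gt0 t0 T_gt0).
    have tn' : t * T < S n.+1.
      rewrite lt_neqAle tn andbT; apply/eqP => E; apply: tS.
      have tT : t * T <= T by rewrite ger_pMl.
      exists n.+1; last by rewrite -E mulfK// gt_eqF.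
      rewrite /= ltnNge; apply/negP => /jump_time_homo; rewrite -E leNgt.
      by rewrite (le_lt_trans tT).
    rewrite (@scaled_pathE n t) ?(ltW nt)//.
    by apply: cvg_near_cst; apply: scaled_path_left; rewrite nt ltW.
  exact/finite_image/finite_II.
- by rewrite /scaled_path mul0r x0 /= mulr0.
Unshelve. all: by end_near. Qed.

End SteppedPath.

Section Tube.
Context {R : realType}.
Variables (f y : trajectory R).

(** The strict bound on the supremum becomes a countable union of non-strict ones,
    each of which can be tested one time at a time. *)
Lemma U_ballP (eps : R) : X_space y ->
  U_ball eps f y <->
  exists k : nat, forall t, 0 <= t <= 1 ->
    euclidean_norm (f t - y t) <= eps - k.+1%:R^-1.
Proof.
move=> Xy; split=> [[_ fy]|[k kP]].
  have le_dist t : 0 <= t <= 1 -> ((euclidean_norm (f t - y t))%:E <= uniform_dist f y)%E.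
    by move=> t01; apply: ereal_sup_ubound; exists t => //=; rewrite in_itv.
  have zle : (0%:E <= uniform_dist f y)%E.
    apply: le_trans (le_dist 0 _); last by rewrite lexx ler01.
    by rewrite lee_fin euclidean_norm_ge0.
  case: (uniform_dist f y) fy zle le_dist => [s||]// seps _ le_dist.
  move: seps; rewrite lte_fin => /ltr_add_invr[k sk].
  exists k => t t01; rewrite lerBrDr.
  by apply: le_trans (ltW sk); rewrite lerD2r -lee_fin; exact: le_dist.
split => //; apply: (@le_lt_trans _ _ (eps - k.+1%:R^-1)%:E).
  apply: ge_ereal_sup => _ [t /= t01 <-]; rewrite lee_fin; apply: kP.
  by move: t01; rewrite in_itv.
by rewrite lte_fin ltrBlDr ltrDl invr_gt0.
Qed.

Hypothesis cf : {within `[0, 1], continuous f}.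
Hypothesis y_right : forall t : R, 0 <= t ->
  exists2 r : R, 0 < r & forall s, t <= s < t + r -> y s = y t.

(** Right-continuity reduces the test to rational times, together with the time 1,
    which has no rational time of the interval on its right. *)
Lemma tube_dense (e : R) :
  euclidean_norm (f 1 - y 1) <= e ->
  (forall q : rat, 0 <= (ratr q : R) <= 1 ->
    euclidean_norm (f (ratr q) - y (ratr q)) <= e) ->
  forall t, 0 <= t <= 1 -> euclidean_norm (f t - y t) <= e.
Proof.
move=> e1 eq t t01; have /andP[t0] := t01.
rewrite le_eqVlt => /predU1P[->//|t1].
apply/ler_addgt0Pr => a a0.
have [r r0 rP] := y_right t0.
have [r' r'0 r'P] := within_continuous_norm cf t01 a0.
have [q] : exists q : rat, ratr q \in `]t, Num.min (t + r) (Num.min (t + r') 1)[.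
  by apply: rat_in_itvoo; rewrite !lt_min !ltrDl r0 r'0 t1.
rewrite in_itv /= !lt_min => /andP[tq /and3P[qr qr' q1]].
have q01 : 0 <= (ratr q : R) <= 1 by rewrite (le_trans t0 (ltW tq)) ltW.
rewrite -(rP (ratr q)) ?(ltW tq)//.
apply: le_trans (euclidean_norm_dist _ (f (ratr q)) _) _.
rewrite addrC lerD//; first exact: eq.
rewrite euclidean_norm_distC; apply: r'P => //.
by rewrite gtr0_norm ?subr_gt0// ltrBlDl.
Qed.

End Tube.

(** * Jump rates and weighted sums over paths *)

Section Rates.
Context {R : realType}.
Variable lambda : step -> R.
Hypothesis lambda_gt0 : forall y, y \in steps -> 0 < lambda y.
Implicit Types (z x : state).

Definition real_point (z : state) : R * R := (z.1%:R, z.2%:R).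

Definition up_rate : R := lambda (1, 0) + lambda (0, 1).

Definition displacement z x : step := (x.1%:Z - z.1%:Z, x.2%:Z - z.2%:Z).

Lemma up_rate_gt0 : 0 < up_rate.
Proof. by rewrite addr_gt0 ?lambda_right_gt0 ?lambda_up_gt0. Qed.

Lemma quadrant_real_point z : quadrant (real_point z).
Proof. by split. Qed.

Lemma natr_minn (m n : nat) : (minn m n)%:R = Num.min m%:R n%:R :> R.
Proof. by case: leqP => mn; [rewrite min_l|rewrite min_r] => //; rewrite ler_nat// ltnW. Qed.

Lemma cost_real_pointE z : cost lambda (real_point z) = z.1%:R * lambda (-1, 0)
  + z.2%:R * lambda (0, -1) + (minn z.1 z.2)%:R * lambda (-1, -1).
Proof. by rewrite /cost /= natr_minn; ring. Qed.

(** The splitting on which everything rests: a bounded upward intensity, and a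
    downward intensity that is homogeneous of degree one in the state. *)
Lemma total_rateE z : total_rate lambda z = up_rate + cost lambda (real_point z).
Proof.
rewrite /total_rate /steps !big_cons big_nil /rate /= /up_rate /cost /= natr_minn.
by ring.
Qed.

Lemma total_rate_gt0 z : 0 < total_rate lambda z.
Proof.
by rewrite total_rateE ltr_wpDr ?up_rate_gt0// cost_ge0//; exact: quadrant_real_point.
Qed.

Lemma rate_ge0 z y : 0 <= rate lambda z y.
Proof.
rewrite /rate; case: ifP => [/orP[]/eqP->|_].
- exact/ltW/lambda_right_gt0.
- exact/ltW/lambda_up_gt0.
case: ifP => [/eqP->|_]; first by rewrite mulr_ge0// ltW// lambda_left_gt0.
case: ifP => [/eqP->|_]; first by rewrite mulr_ge0// ltW// lambda_down_gt0.
by case: ifP => [/eqP->|_//]; rewrite mulr_ge0// ltW// lambda_diag_gt0.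
Qed.

Lemma jump_prob_ge0 z x : 0 <= jump_prob lambda z x.
Proof. by rewrite divr_ge0 ?rate_ge0// ltW// total_rate_gt0. Qed.

Lemma sum_indicator_le (s : seq state) (u : state) (K : R) : uniq s -> 0 <= K ->
  \sum_(x <- s) (if x == u then K else 0) <= K.
Proof.
move=> us K0; rewrite -big_mkcond /=.
have [us'|us'] := boolP (u \in s); first by rewrite -big_filter filter_pred1_uniq// big_seq1.
rewrite big_seq_cond big_pred0// => x; apply/negbTE/negP => /andP[xs /eqP xu].
by rewrite -xu xs in us'.
Qed.

(** The jump rates applied to a function of the target state. A truncated
    predecessor of 0 comes with the factor 0. *)
Definition jump_sum (F : state -> R) z : R :=
  lambda (1, 0) * F (z.1.+1, z.2) + lambda (0, 1) * F (z.1, z.2.+1)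
  + z.1%:R * lambda (-1, 0) * F (z.1.-1, z.2)
  + z.2%:R * lambda (0, -1) * F (z.1, z.2.-1)
  + (minn z.1 z.2)%:R * lambda (-1, -1) * F (z.1.-1, z.2.-1).

(** Each of the five steps leads to at most one member of [s]. *)
Lemma sum_rate_le (s : seq state) (F : state -> R) z :
  uniq s -> (forall x, 0 <= F x) ->
  \sum_(x <- s) rate lambda z (displacement z x) * F x <= jump_sum F z.
Proof.
move=> us F0.
have l1 := lambda_right_gt0 lambda_gt0; have l2 := lambda_up_gt0 lambda_gt0.
have l3 := lambda_left_gt0 lambda_gt0; have l4 := lambda_down_gt0 lambda_gt0.
have l5 := lambda_diag_gt0 lambda_gt0.
pose t u K x : R := if x == u :> state then K * F u else 0.
have t0 u K x : 0 <= K -> 0 <= t u K x by move=> K0; rewrite /t; case: ifP => // _; rewrite mulr_ge0.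
have K3 : 0 <= z.1%:R * lambda (-1, 0) by rewrite mulr_ge0// ltW.
have K4 : 0 <= z.2%:R * lambda (0, -1) by rewrite mulr_ge0// ltW.
have K5 : 0 <= (minn z.1 z.2)%:R * lambda (-1, -1) by rewrite mulr_ge0// ltW.
pose T x := t (z.1.+1, z.2) (lambda (1, 0)) x + t (z.1, z.2.+1) (lambda (0, 1)) x
  + t (z.1.-1, z.2) (z.1%:R * lambda (-1, 0)) x
  + t (z.1, z.2.-1) (z.2%:R * lambda (0, -1)) x
  + t (z.1.-1, z.2.-1) ((minn z.1 z.2)%:R * lambda (-1, -1)) x.
apply: (@le_trans _ _ (\sum_(x <- s) T x)); last first.
  by rewrite !big_split /= !lerD// sum_indicator_le// mulr_ge0// ltW.
apply: ler_sum => x _; rewrite /T.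
have T1 := t0 (z.1.+1, z.2) _ x (ltW l1); have T2 := t0 (z.1, z.2.+1) _ x (ltW l2).
have T3 := t0 (z.1.-1, z.2) _ x K3; have T4 := t0 (z.1, z.2.-1) _ x K4.
have T5 := t0 (z.1.-1, z.2.-1) _ x K5.
have tE u K : x = u -> t u K x = K * F x by move=> ->; rewrite /t eqxx.
have sum0 (a b c e g : R) : 0 <= a -> 0 <= b -> 0 <= c -> 0 <= e -> 0 <= g -> 
  [/\ a <= a + b + c + e + g, b <= a + b + c + e + g, c <= a + b + c + e + g,
     e <= a + b + c + e + g & g <= a + b + c + e + g] by move=> *; split; lra.
have [S1 S2 S3 S4 S5] := sum0 _ _ _ _ _ T1 T2 T3 T4 T5.
have xE (a b : nat) : x.1 = a -> x.2 = b -> x = (a, b) by case: (x) => ? ? /= -> ->.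
rewrite /rate /displacement.
case: ifP => [/orP[]/eqP dE|_].
- rewrite {1}dE; case: dE => e1 e2; apply: le_trans _ S1.
  by rewrite tE//; apply: xE; move: e1 e2; clear; lia.
- rewrite {1}dE; case: dE => e1 e2; apply: le_trans _ S2.
  by rewrite tE//; apply: xE; move: e1 e2; clear; lia.
case: ifP => [/eqP dE|_].
  rewrite {1}dE; case: dE => e1 e2; apply: le_trans _ S3.
  by rewrite tE//; apply: xE; move: e1 e2; clear; lia.
case: ifP => [/eqP dE|_].
  rewrite {1}dE; case: dE => e1 e2; apply: le_trans _ S4.
  by rewrite tE//; apply: xE; move: e1 e2; clear; lia.
case: ifP => [/eqP dE|_]; last by rewrite mul0r !addr_ge0.
rewrite {1}dE; case: dE => e1 e2; apply: le_trans _ S5.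
by rewrite tE//; apply: xE; move: e1 e2; clear; lia.
Qed.

Lemma jump_sum1 z : jump_sum (fun=> 1) z = total_rate lambda z.
Proof.
rewrite total_rateE /jump_sum /up_rate /cost /= natr_minn; ring.
Qed.

Lemma sum_jump_prob_le1 (s : seq state) z : uniq s ->
  \sum_(x <- s) jump_prob lambda z x <= 1.
Proof.
move=> us; rewrite -mulr_suml ler_pdivrMr ?total_rate_gt0// mul1r.
rewrite -jump_sum1; apply: le_trans (sum_rate_le z us (fun=> ler01)).
by apply: ler_sum => x _; rewrite mulr1.
Qed.

(** A finite set outside of which no jump from [z] leads. *)
Definition near_states z : seq state :=
  [seq (i, j) | i <- iota 0 z.1.+2, j <- iota 0 z.2.+2].

Lemma near_states_uniq z : uniq (near_states z).
Proof.
by apply: allpairs_uniq; rewrite ?iota_uniq// => -[? ?] [? ?].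
Qed.

Lemma jump_prob_far z x : x \notin near_states z -> jump_prob lambda z x = 0.
Proof.
move=> xz; rewrite /jump_prob.
suff -> : rate lambda z (displacement z x) = 0 by rewrite mul0r.
have far y : y \in steps -> displacement z x != y.
  move=> yS; apply/eqP => dE; move/negP : xz; apply; apply/allpairsP; exists x.
  have [h1 h2] : (x.1 < z.1.+2 /\ x.2 < z.2.+2)%N.
    move: yS; rewrite -dE /steps !inE !xpair_eqE /displacement.
    by clear; lia.
  by split; rewrite ?mem_iota ?add0n//; case: (x).
by rewrite /rate !(negbTE (far _ _)).
Qed.

End Rates.

Section PathSum.
Context {R : realType}.
Variable lambda : step -> R.
Hypothesis lambda_gt0 : forall y, y \in steps -> 0 < lambda y.
Variables (K a q : R).
Hypothesis a_ge1 : 1 <= a.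
Hypothesis q_gt0 : 0 < q.
Variable b : seq state.
Hypothesis b_uniq : uniq b.
Hypothesis b_cost : forall z, z \in b -> cost lambda (real_point z) <= K.
Implicit Types (z x : state) (s : seq state).

Definition level z : nat := (z.1 + z.2)%N.

(** What is left of the product of the transition rates along a path when the
    exponential tilt has replaced every total rate by the constant [q]. *)
Fixpoint path_weight z s : R := if s is x :: s' then
  rate lambda z (displacement z x) / q * path_weight x s' else 1.

Fixpoint paths (N : nat) : seq (seq state) := if N is N'.+1 then
  [seq x :: s | x <- b, s <- paths N'] else [:: [::]].

(** A jump up multiplies [a ^+ level] by [a] and a jump down divides it by [a] or
    [a ^+ 2]. Without this weight the downward jumps would have a rate of order
    [K], which is as large as the exponent to be computed; with it they are damped
    by the factor [1 / a]. *)
Lemma jump_sum_level z : cost lambda (real_point z) <= K ->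
  jump_sum lambda (fun x => a ^+ level x) z <= (up_rate lambda * a + K / a) * a ^+ level z.
Proof.
move=> zK; have a0 : 0 < a by exact: lt_le_trans a_ge1.
have l3 := lambda_left_gt0 lambda_gt0; have l4 := lambda_down_gt0 lambda_gt0.
have l5 := lambda_diag_gt0 lambda_gt0.
case: z zK => m n zK; rewrite /jump_sum /level /=.
have L0 : 0 < a ^+ (m + n) by rewrite exprn_gt0.
have E1 : m%:R * lambda (-1, 0) * a ^+ (m.-1 + n) = m%:R * lambda (-1, 0) / a * a ^+ (m + n).
  case: m {zK L0} => [|m]; first by rewrite !mul0r.
  by rewrite /= addSn exprS -[RHS]mulrA mulKf ?gt_eqF.
have E2 : n%:R * lambda (0, -1) * a ^+ (m + n.-1) = n%:R * lambda (0, -1) / a * a ^+ (m + n).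
  case: n {zK L0 E1} => [|n]; first by rewrite !mul0r.
  by rewrite /= addnS exprS -[RHS]mulrA mulKf ?gt_eqF.
have E3 : (minn m n)%:R * lambda (-1, -1) * a ^+ (m.-1 + n.-1) <=
    (minn m n)%:R * lambda (-1, -1) / a * a ^+ (m + n).
  case: m {zK L0 E1 E2} => [|m]; first by rewrite min0n !mul0r.
  case: n => [|n]; first by rewrite minn0 !mul0r.
  rewrite /= addSn addnS !exprS -[leRHS]mulrA mulKf ?gt_eqF//.
  rewrite ler_wpM2l//; first by rewrite mulr_ge0// ltW.
  by rewrite ler_peMl// exprn_ge0// ltW.
rewrite E1 E2 addSn addnS !exprS /up_rate.
apply: (@le_trans _ _ ((lambda (1, 0) + lambda (0, 1)) * a * a ^+ (m + n)
   + cost lambda (real_point (m, n)) / a * a ^+ (m + n))).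
  rewrite cost_real_pointE /=.
  apply: le_trans (lerD (lexx _) E3) _; rewrite le_eqVlt; apply/orP; left; apply/eqP; ring.
by rewrite [leRHS]mulrDl lerD2l ler_pM2r// ler_pM2r// invr_gt0.
Qed.

Lemma path_weight_ge0 z s : 0 <= path_weight z s.
Proof.
elim: s z => //= x s IH z.
by rewrite mulr_ge0// divr_ge0 ?rate_ge0// ltW.
Qed.

(** The level of the endpoint of a path is a natural number, so its weight is at
    least 1 and can be left out of the sum. *)
Lemma sum_path_weight N z : cost lambda (real_point z) <= K ->
  \sum_(s <- paths N) path_weight z s <=
  ((up_rate lambda * a + K / a) / q) ^+ N * a ^+ level z.
Proof.
elim: N z => [|N IH] z zK.
  by rewrite big_seq1 expr0 mul1r exprn_ege1.
have a0 : 0 < a by exact: lt_le_trans a_ge1.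
have K0 : 0 <= K by apply: le_trans zK; rewrite cost_ge0//; exact: quadrant_real_point.
set r := (_ + _) / q in IH *.
have r0 : 0 <= r.
  by rewrite divr_ge0 ?addr_ge0 ?mulr_ge0 ?invr_ge0// ?(ltW (up_rate_gt0 lambda_gt0)) ?ltW.
rewrite /= big_allpairs_dep /=.
apply: (@le_trans _ _ (\sum_(x <- b) rate lambda z (displacement z x) *
    a ^+ level x * (q^-1 * r ^+ N))).
  rewrite big_seq [leRHS]big_seq; apply: ler_sum => x xb.
  rewrite -mulr_sumr -!mulrA ler_wpM2l ?rate_ge0//.
  rewrite [leRHS]mulrCA ler_wpM2l ?invr_ge0 ?(ltW q_gt0)//.
  by rewrite [leRHS]mulrC; apply: IH; exact: b_cost.
rewrite -mulr_suml.
apply: (@le_trans _ _ ((up_rate lambda * a + K / a) * a ^+ level z * (q^-1 * r ^+ N))).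
  rewrite ler_wpM2r ?mulr_ge0 ?invr_ge0 ?exprn_ge0 ?(ltW q_gt0)//.
  apply: le_trans (jump_sum_level zK).
  by apply: sum_rate_le => // x; rewrite exprn_ge0// ltW.
by rewrite exprS /r; rewrite le_eqVlt; apply/orP; left; apply/eqP; ring.
Qed.

Lemma path_weightE z s x0 : path_weight z s =
  \prod_(i < size s) (rate lambda (nth x0 (z :: s) i)
    (displacement (nth x0 (z :: s) i) (nth x0 (z :: s) i.+1)) / q).
Proof.
elim: s z => [|x s IH] z; first by rewrite big_ord0.
by rewrite /= big_ord_recl /= (IH x).
Qed.

Lemma mem_paths s : all (fun x => x \in b) s -> s \in paths (size s).
Proof.
elim: s => [|x s IH] //= /andP[xb /IH sP].
by apply/allpairsP; exists (x, s).
Qed.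

Lemma size_paths N s : s \in paths N -> size s = N.
Proof.
elim: N s => [|N IH] s /=; first by rewrite inE => /eqP ->.
by move=> /allpairsP[[x s'] /= [_ /IH <- ->]].
Qed.

Lemma paths_box N s : s \in paths N -> all (fun x => x \in b) s.
Proof.
elim: N s => [|N IH] s /=; first by rewrite inE => /eqP ->.
by move=> /allpairsP[[x s'] /= [xb /IH ss ->]] /=; rewrite xb ss.
Qed.

End PathSum.

Section CostBox.
Context {R : realType}.
Variable lambda : step -> R.
Hypothesis lambda_gt0 : forall y, y \in steps -> 0 < lambda y.

Lemma cost_box (K : R) : exists b : seq state, uniq b /\
  forall z, (z \in b) = (cost lambda (real_point z) <= K).
Proof.
have l3 := lambda_left_gt0 lambda_gt0; have l4 := lambda_down_gt0 lambda_gt0.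
have l5 := lambda_diag_gt0 lambda_gt0.
have [K0|K0] := ltP K 0.
  exists [::]; split => // z; rewrite in_nil; apply/esym/negbTE; rewrite -ltNge.
  by apply: lt_le_trans K0 _; rewrite cost_ge0//; exact: quadrant_real_point.
pose M1 := Num.bound (K / lambda (-1, 0)); pose M2 := Num.bound (K / lambda (0, -1)).
exists [seq z <- [seq (i, j) | i <- iota 0 M1, j <- iota 0 M2] | cost lambda (real_point z) <= K].
split.
  by apply: filter_uniq; apply: allpairs_uniq; rewrite ?iota_uniq// => -[? ?] [? ?].
move=> z; rewrite mem_filter; case: (boolP (cost _ _ <= K)) => [zK|//]; rewrite andTb.
apply/allpairsP; exists z; rewrite !mem_iota !leq0n !add0n !andTb.
have z3 : 0 <= (minn z.1 z.2)%:R * lambda (-1, -1) by rewrite mulr_ge0// ltW.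
have z1 : 0 <= z.1%:R * lambda (-1, 0) by rewrite mulr_ge0// ltW.
have z2 : 0 <= z.2%:R * lambda (0, -1) by rewrite mulr_ge0// ltW.
move: zK; rewrite cost_real_pointE => zK.
split; last by case: (z).
- rewrite -(ltr_nat R); apply: le_lt_trans (archi_boundP _).
    rewrite ler_pdivlMr//; lra.
  by rewrite divr_ge0// ltW.
- rewrite -(ltr_nat R); apply: le_lt_trans (archi_boundP _).
    rewrite ler_pdivlMr//; lra.
  by rewrite divr_ge0// ltW.
Qed.

End CostBox.

(** * The cost of a tube *)

Section TubeCost.
Context {R : realType}.
Variable lambda : step -> R.
Hypothesis lambda_gt0 : forall y, y \in steps -> 0 < lambda y.
Variable f : trajectory R.
Hypothesis Ff : F_space f.

Lemma F_space_continuous : {within `[0, 1], continuous f}.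
Proof. by case: Ff. Qed.

Lemma F_space_quadrant t : 0 <= t <= 1 -> quadrant (f t).
Proof. by have [[fge0 _ _ _] _ _] := Ff; exact: fge0. Qed.

Lemma min_cost_continuous eps : 0 < eps ->
  {within `[0, 1], continuous (fun t => min_cost lambda eps (f t))}.
Proof.
move=> eps0; apply: (within_continuous_lip F_space_continuous (cost_lip_gt0 lambda_gt0)).
move=> x y x01 y01; apply: min_cost_dist => //; exact: F_space_quadrant.
Qed.

Lemma cost_continuous : {within `[0, 1], continuous (fun t => cost lambda (f t))}.
Proof.
apply: (within_continuous_lip F_space_continuous (cost_lip_gt0 lambda_gt0)).
by move=> x y x01 y01; exact: cost_dist.
Qed.

(** The rate of decay for a tube of fixed radius. The infimum is taken separately
    at each time: a trajectory of the tube may jump from one cheap region to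
    another, because jumps cost nothing on the scale of [T ^+ 2]. *)
Definition tube_cost eps : R := path_integral (fun t => min_cost lambda eps (f t)) 0 1.

Variables (Z : nat -> state) (tau : nat -> R) (x : R -> state) (T eps : R).
Hypothesis T_gt0 : 0 < T.
Hypothesis eps_gt0 : 0 < eps.
Hypothesis tau_gt0 : forall n, 0 < tau n.
Hypothesis xE : forall n (t : R),
  \sum_(i < n) tau i <= t < \sum_(i < n.+1) tau i -> x t = Z n.
Hypothesis tube : forall t, 0 <= t <= 1 -> euclidean_norm (f t - scaled_path x T t) < eps.

Local Notation S n := (\sum_(i < n) tau i).
Local Notation Phi := (path_integral (fun t => min_cost lambda eps (f t))).
Let c i := cost lambda (real_point (Z i)).

Let jump_time_ge0 n : 0 <= S n.
Proof. by rewrite sumr_ge0// => i _; rewrite ltW. Qed.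

Let sojourn_cost n (b : R) : S n <= b * T -> b * T <= S n.+1 -> b <= 1 ->
  Phi (S n / T) b <= c n / T * (b - S n / T).
Proof.
move=> nb bn b1.
apply: path_integral_le; first exact: min_cost_continuous.
- by rewrite divr_ge0// ltW.
- by rewrite ler_pdivrMr.
- by [].
move=> t /andP[nt tb].
have t01 : 0 <= t <= 1.
  apply/andP; split; last exact: le_trans (ltW tb) b1.
  by apply: le_trans nt; rewrite divr_ge0 ?(ltW T_gt0).
have tE : scaled_path x T t = (T^-1 * (Z n).1%:R, T^-1 * (Z n).2%:R).
  apply: (scaled_pathE (tau := tau)) => //.
  by rewrite -ler_pdivrMr// nt (lt_le_trans _ bn)// ltr_pM2r.
rewrite [leRHS]mulrC -cost_scale ?invr_ge0 ?(ltW T_gt0)//.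
apply: min_cost_le => //.
  by split; rewrite mulr_ge0 ?invr_ge0 ?(ltW T_gt0).
by rewrite -tE euclidean_norm_distC tube.
Qed.

(** During the sojourn in [Z i] the rescaled state is admissible in the infimum that
    defines [min_cost], so its cost bounds the integrand. One factor [T] comes from
    the homogeneity of [cost], the other from the change of time scale. *)
Lemma tube_cost_le N : S N <= T -> T < S N.+1 ->
  T ^+ 2 * tube_cost eps <= \sum_(i < N.+1) c i * tau i.
Proof.
move=> NT TN.
have cphi := min_cost_continuous eps_gt0.
have partial n : (n <= N)%N -> T ^+ 2 * Phi 0 (S n / T) <= \sum_(i < n) c i * tau i.
  elim: n => [_|n IH nN].
    rewrite !big_ord0 mul0r; apply: mulr_ge0_le0; first exact: sqr_ge0.
    apply: le_trans (path_integral_le (C := 0) cphi (lexx _) (lexx _) ler01 _) _.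
      by move=> t /andP[/le_lt_trans h /h]; rewrite ltxx.
    by rewrite subrr mulr0.
  have nT : S n.+1 <= T by apply: le_trans NT; exact: jump_time_homo.
  have n1 : S n.+1 / T <= 1 by rewrite ler_pdivrMr// mul1r.
  have nn : S n / T <= S n.+1 / T by rewrite ler_pM2r ?invr_gt0// ltW// jump_time_lt.
  rewrite (path_integralD cphi (lexx 0) _ nn n1); last by rewrite divr_ge0// ltW.
  rewrite mulrDr [leRHS]big_ord_recr /= lerD// ?IH ?(ltnW nN)//.
  have := @sojourn_cost n (S n.+1 / T).
  rewrite divfK ?gt_eqF// => /(_ (ltW (jump_time_lt tau_gt0 n)) (lexx _) n1).
  rewrite -mulrBl => /(ler_wpM2l (sqr_ge0 T)) /le_trans; apply.
  rewrite le_eqVlt; apply/orP; left; apply/eqP.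
  have -> : S n.+1 - S n = tau n by rewrite big_ord_recr /=; ring.
  by field; rewrite gt_eqF.
have N1 : S N / T <= 1 by rewrite ler_pdivrMr// mul1r.
rewrite /tube_cost (path_integralD cphi (lexx 0) _ N1 (lexx 1)); last by rewrite divr_ge0// ltW.
rewrite mulrDr [leRHS]big_ord_recr /= lerD// ?partial//.
have := @sojourn_cost N 1.
rewrite mul1r => /(_ NT (ltW TN) (lexx _)) /(ler_wpM2l (sqr_ge0 T)) /le_trans; apply.
have -> : T ^+ 2 * (c N / T * (1 - S N / T)) = c N * (T - S N).
  by field; rewrite gt_eqF.
apply: ler_wpM2l; first by apply: cost_ge0 => //; exact: quadrant_real_point.
by rewrite lerBlDl; move: TN; rewrite big_ord_recr /= => /ltW.
Qed.

End TubeCost.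

Section RiemannSum.
Context {R : realType}.
Variable lambda : step -> R.
Hypothesis lambda_gt0 : forall y, y \in steps -> 0 < lambda y.
Variable f : trajectory R.
Hypothesis Ff : F_space f.

Lemma cost_bounded : exists2 K, 0 <= K & forall t, 0 <= t <= 1 -> cost lambda (f t) <= K.
Proof.
have [c c01 cmax] := EVT_max ler01 (cost_continuous lambda_gt0 Ff).
have cE : 0 <= c <= 1 by move: c01; rewrite in_itv.
exists (cost lambda (f c)).
  by apply: cost_ge0 => //; exact: F_space_quadrant Ff _ cE.
by move=> t t01; apply: cmax; rewrite in_itv.
Qed.

Variables (eps eta : R) (n : nat).
Hypothesis n_gt0 : (0 < n)%N.
Hypothesis eps_gt0 : 0 < eps.
Hypothesis modulus : forall s t, 0 <= s <= 1 -> 0 <= t <= 1 ->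
  `|t - s| <= n%:R^-1 -> euclidean_norm (f t - f s) <= eta.

(** Over one slot the centre moves by at most [eta], and [min_cost] is Lipschitz in
    the centre. *)
Lemma riemann_sum_le :
  \sum_(j < n) min_cost lambda eps (f (j%:R / n%:R)) / n%:R <=
  tube_cost lambda f eps + cost_lip lambda * eta.
Proof.
have n0 : (0 : R) < n%:R by rewrite ltr0n.
have cL := cost_lip_gt0 lambda_gt0.
have cphi := min_cost_continuous lambda_gt0 Ff eps_gt0.
have slot k : (k <= n)%N ->
  \sum_(j < k) (min_cost lambda eps (f (j%:R / n%:R)) - cost_lip lambda * eta) / n%:R <=
  path_integral (fun t => min_cost lambda eps (f t)) 0 (k%:R / n%:R).
  elim: k => [_|k IH kn].
    rewrite big_ord0 mul0r.
    apply: (le_trans _ (path_integral_ge (C := 0) cphi (lexx _) (lexx _) ler01 _)).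
      by rewrite subrr mulr0.
    move=> t /andP[t0 t1]; apply: (min_cost_ge0 lambda_gt0) => //.
    by apply: (F_space_quadrant Ff); rewrite t0 (le_trans t1).
  have k1 : k.+1%:R / n%:R <= 1 :> R by rewrite ler_pdivrMr// mul1r ler_nat.
  have kk : k%:R / n%:R <= k.+1%:R / n%:R :> R by rewrite ler_pM2r ?invr_gt0// ler_nat.
  have k0 : 0 <= k%:R / n%:R :> R by rewrite divr_ge0.
  have dk : k.+1%:R / n%:R - k%:R / n%:R = n%:R^-1 :> R.
    by rewrite -mulrBl -natr1 addrAC subrr add0r mul1r.
  rewrite (path_integralD cphi (lexx 0) k0 kk k1) big_ord_recr /= lerD// ?IH ?(ltnW kn)//.
  rewrite -[X in _ * X <= _]dk.
  apply: path_integral_ge => // t /andP[kt tk].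
  have k01 : 0 <= (k%:R / n%:R : R) <= 1 by rewrite k0 (le_trans kk).
  have t01 : 0 <= t <= 1 by rewrite (le_trans k0 kt) (le_trans tk).
  rewrite lerBlDr; apply: le_trans (min_cost_dist lambda_gt0 eps_gt0
    (F_space_quadrant Ff t01) (F_space_quadrant Ff k01)) _.
  rewrite lerD2l ler_pM2l// euclidean_norm_distC; apply: modulus => //.
  rewrite ger0_norm ?subr_ge0//.
  apply: (@le_trans _ _ (k.+1%:R / n%:R - k%:R / n%:R)); last by rewrite dk.
  by rewrite lerD2r.
have := slot n (leqnn n); rewrite divff ?gt_eqF// -/(tube_cost lambda f eps).
rewrite -!mulr_suml big_split /= sumr_const card_ord -[X in _ + X]mulr_natl mulrDl.
by rewrite mulrN mulNr mulrAC divff ?gt_eqF// mul1r lerBlDr.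
Qed.

End RiemannSum.

(** * Plans *)

Section Strategy.
Context {R : realType}.
Variable lambda : step -> R.
Hypothesis lambda_gt0 : forall y, y \in steps -> 0 < lambda y.
Variables (rho delta sigma : R) (ok : state -> R -> Prop).
Hypothesis delta_gt0 : 0 < delta.
Local Notation h := (total_rate lambda).

(** A plan prescribes states and sojourn times; [reach N D x C] says that one with
    [N] jumps is in [x] at time [D], at a cost of at most [C], the integral of the
    total rate. The actual sojourns will be shorter than the prescribed ones by at
    most [delta] each, so a state has to be acceptable from [sigma] before its
    prescribed arrival on. The time [e] spent in the current state becomes part of
    a sojourn only when the next jump is decided, since consecutive waits in the
    same state are one sojourn. *)
Definition reach (N : nat) (D : R) (x : state) (C : R) : Prop :=
  exists (z : nat -> state) (dur : nat -> R) (e : R),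
  [/\ z 0%N = (0%N, 0%N) /\ z N = x,
      forall i, (i < N)%N ->
        rho <= rate lambda (z i) (displacement (z i) (z i.+1)) /\ delta <= dur i,
      forall i, (i < N)%N -> forall u,
        \sum_(j < i) dur j - sigma <= u <= \sum_(j < i.+1) dur j -> ok (z i) u,
      [/\ 0 <= e, D = \sum_(j < N) dur j + e &
        forall u, \sum_(j < N) dur j - sigma <= u <= D -> ok x u] &
      \sum_(i < N) h (z i) * dur i + h x * e <= C].

Lemma reach_start : (forall u, - sigma <= u <= 0 -> ok (0%N, 0%N) u) ->
  reach 0 0 (0%N, 0%N) 0.
Proof.
move=> ok0; exists (fun=> (0%N, 0%N)), (fun=> 0), 0; split => //.
- by split; rewrite ?big_ord0 ?addr0// sub0r.
- by rewrite big_ord0 mulr0 addr0.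
Qed.

Lemma reach_wait N D x C s : reach N D x C -> 0 <= s ->
  (forall u, D <= u <= D + s -> ok x u) -> reach N (D + s) x (C + h x * s).
Proof.
move=> [z [dur [e [z0N rt okz [e0 DE okx] cost_le]]]] s0 oks.
exists z, dur, (e + s); split => //.
- split; rewrite ?addr_ge0// ?addrA -?DE// => u /andP[h1 h2].
  have [uD|/ltW Du] := leP u D; first by apply: okx; rewrite h1 uD.
  by apply: oks; rewrite Du.
- by rewrite mulrDr addrA lerD2r.
Qed.

(** The extra [delta] makes the committed sojourn long enough even if no time was
    spent waiting. *)
Lemma reach_commit N D x C x' : reach N D x C ->
  rho <= rate lambda x (displacement x x') ->
  (forall u, D <= u <= D + delta -> ok x u) ->
  exists (z : nat -> state) (dur : nat -> R),
  [/\ z 0%N = (0%N, 0%N) /\ z N.+1 = x',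
      forall i, (i < N.+1)%N ->
        rho <= rate lambda (z i) (displacement (z i) (z i.+1)) /\ delta <= dur i,
      forall i, (i < N.+1)%N -> forall u,
        \sum_(j < i) dur j - sigma <= u <= \sum_(j < i.+1) dur j -> ok (z i) u,
      \sum_(j < N.+1) dur j = D + delta &
      \sum_(i < N.+1) h (z i) * dur i <= C + h x * delta].
Proof.
move=> [z [dur [e [[z0 zN] rt okz [e0 DE okx] cost_le]]]] rx okx1.
pose z' i := if (i <= N)%N then z i else x'.
pose dur' i := if (i < N)%N then dur i else e + delta.
have z'E i : (i <= N)%N -> z' i = z i by rewrite /z' => ->.
have z'S : z' N.+1 = x' by rewrite /z' ltnn.
have sumE (F : nat -> R -> R) m : (m <= N)%N ->
    \sum_(j < m) F j (dur' j) = \sum_(j < m) F j (dur j).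
  by move=> mN; apply: eq_bigr => j _; rewrite /dur' (leq_trans (ltn_ord j) mN).
have durN : dur' N = e + delta by rewrite /dur' ltnn.
have DN : \sum_(j < N.+1) dur' j = D + delta.
  by rewrite big_ord_recr /= (sumE (fun=> id))// durN DE addrA.
exists z', dur'; split => //.
- move=> i; rewrite ltnS leq_eqVlt => /predU1P[->|iN].
    by rewrite z'E// z'S zN durN lerDr.
  by rewrite (z'E i (ltnW iN)) (z'E i.+1 iN) /dur' iN; exact: rt.
- move=> i; rewrite ltnS leq_eqVlt => /predU1P[->|iN] u.
    rewrite DN z'E// zN (sumE (fun=> id))// => /andP[h1 h2].
    have [uD|/ltW Du] := leP u D; first by apply: okx; rewrite h1 uD.
    by apply: okx1; rewrite Du.
  rewrite (sumE (fun=> id) i (ltnW iN)) (sumE (fun=> id) i.+1 iN) (z'E i (ltnW iN)).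
  exact: okz.
- rewrite big_ord_recr /= durN z'E// zN mulrDr addrA lerD2r.
  apply: le_trans cost_le; rewrite lerD2r le_eqVlt; apply/orP; left; apply/eqP.
  by apply: eq_bigr => j _; rewrite (z'E j (ltnW (ltn_ord j))) /dur' ltn_ord.
Qed.

Lemma reach_move N D x C x' : reach N D x C ->
  rho <= rate lambda x (displacement x x') ->
  (forall u, D <= u <= D + delta -> ok x u) ->
  (forall u, D + delta - sigma <= u <= D + delta -> ok x' u) ->
  reach N.+1 (D + delta) x' (C + h x * delta).
Proof.
move=> rx rate_le okx okx'.
have [z [dur [z0N rt okz DN cost_le]]] := reach_commit rx rate_le okx.
exists z, dur, 0; split => //; last by rewrite mulr0 addr0.
by split; rewrite ?addr0 ?DN.
Qed.

Definition dist1 (x y : state) : nat :=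
  ((x.1 - y.1) + (y.1 - x.1) + ((x.2 - y.2) + (y.2 - x.2)))%N.

Definition between (x y u : state) : Prop :=
  ((minn x.1 y.1 <= u.1 <= maxn x.1 y.1) /\ (minn x.2 y.2 <= u.2 <= maxn x.2 y.2))%N.

Hypothesis rho_le : [/\ rho <= lambda (1, 0), rho <= lambda (0, 1),
  rho <= lambda (-1, 0) & rho <= lambda (0, -1)].

Lemma unit_step x y : x <> y -> exists x',
  [/\ rho <= rate lambda x (displacement x x'), between x y x',
      dist1 x y = (dist1 x' y).+1 & forall u, between x' y u -> between x y u].
Proof.
move=> xy; have [r1 r2 r3 r4] := rho_le.
have l3 := lambda_left_gt0 lambda_gt0; have l4 := lambda_down_gt0 lambda_gt0.
have scale (m : nat) (l : R) : (0 < m)%N -> 0 < l -> rho <= l -> rho <= m%:R * l.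
  by move=> m0 l0 /le_trans; apply; rewrite ler_peMl ?ler1n// ltW.
case: x y xy => [a b] [a' b'] xy; rewrite /dist1 /between /=.
have [aa|aa|aa] := ltngtP a a'.
- exists (a.+1, b); split => /=; try (clear -aa; lia).
  by rewrite (_ : displacement _ _ = (1, 0))//; rewrite /displacement /=; congr pair; clear; lia.
- exists (a.-1, b); split => /=; try (clear -aa; lia).
  rewrite (_ : displacement _ _ = (-1, 0)); last by rewrite /displacement /=; congr pair; clear -aa; lia.
  by apply: scale => //; case: (a) aa.
have [bb|bb|bb] := ltngtP b b'.
- exists (a, b.+1); split => /=; try (clear -aa bb; lia).
  by rewrite (_ : displacement _ _ = (0, 1))//; rewrite /displacement /=; congr pair; clear; lia.
- exists (a, b.-1); split => /=; try (clear -aa bb; lia).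
  rewrite (_ : displacement _ _ = (0, -1)); last by rewrite /displacement /=; congr pair; clear -bb; lia.
  by apply: scale => //; case: (b) bb.
by case: xy; rewrite aa bb.
Qed.

(** A walk along the axes that never steps back visits only states of the
    coordinate box spanned by its endpoints. *)
Lemma reach_hop N D x C y H : reach N D x C ->
  (forall u, between x y u -> h u <= H) ->
  (forall u t, between x y u -> D - sigma <= t <= D + (dist1 x y)%:R * delta -> ok u t) ->
  0 <= sigma ->
  reach (N + dist1 x y) (D + (dist1 x y)%:R * delta) y (C + (dist1 x y)%:R * delta * H).
Proof.
move=> + + + sigma0.
have [m] := ubnP (dist1 x y); elim: m => // m IH in N D x C *.
rewrite ltnS => dm rx hH oku.
have [xy|xy] := pselect (x = y).
  have -> : dist1 x y = 0%N by rewrite xy /dist1; clear; lia.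
  by rewrite addn0 !mul0r !addr0 -xy.
have [x' [rate_le x'b dE sub]] := unit_step xy.
have bx : between x y x by rewrite /between; clear; lia.
have dx' : (dist1 x y)%:R * delta = delta + (dist1 x' y)%:R * delta :> R.
  by rewrite dE -natr1 mulrDl mul1r addrC.
have d0 : 0 <= (dist1 x' y)%:R * delta by rewrite mulr_ge0// ltW.
have rx' : reach N.+1 (D + delta) x' (C + h x * delta).
  apply: reach_move rx rate_le _ _ => u /andP[h1 h2].
    by apply: oku => //; rewrite dx'; apply/andP; split; lra.
  by apply: oku => //; rewrite dx'; apply/andP; split; move: delta_gt0; lra.
have dm' : (dist1 x' y < m)%N by rewrite -dE.
have [|z [dur [e [z0N rt okz okx cost_le]]]] :=
    IH _ _ _ _ dm' rx' (fun u xu => hH u (sub u xu)).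
  move=> u t /sub bu /andP[h1 h2]; apply: oku => //; rewrite dx'.
  by apply/andP; split; move: delta_gt0; lra.
rewrite dE addnS -addSn -dE dx' addrA.
exists z, dur, e; split => //; apply: le_trans cost_le _.
rewrite mulrDl addrA lerD2r lerD2l mulrC ler_pM2l//.
exact: hH.
Qed.

End Strategy.

(** Nothing is asked beyond the horizon [T]: a plan has to run past [T], so that its
    early execution still covers the whole time interval. *)
Definition tube_ok (R : realType) (f : trajectory R) (T e : R) (x : state) (u : R) : Prop :=
  0 <= u <= T -> euclidean_norm (f (u / T) - (T^-1 * x.1%:R, T^-1 * x.2%:R)) <= e.

Section FollowPlan.
Context {R : realType}.
Variables (Z z : nat -> state) (tau dur : nat -> R) (x : R -> state).
Variables (f : trajectory R) (T e delta sigma : R) (N : nat).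
Hypothesis T_gt0 : 0 < T.
Hypothesis tau_gt0 : forall n, 0 < tau n.
Hypothesis tau_unbounded : forall t : R, exists n, t < \sum_(i < n) tau i.
Hypothesis xE : forall n (t : R),
  \sum_(i < n) tau i <= t < \sum_(i < n.+1) tau i -> x t = Z n.
Hypothesis delta_ge0 : 0 <= delta.
Hypothesis Zz : forall i, (i <= N)%N -> Z i = z i.
Hypothesis window : forall i, (i < N)%N -> dur i - delta < tau i < dur i.
Hypothesis plan_ok : forall i, (i < N)%N -> forall u,
  \sum_(j < i) dur j - sigma <= u <= \sum_(j < i.+1) dur j -> tube_ok f T e (z i) u.
Hypothesis slack : N%:R * delta <= sigma.
Hypothesis covers : T < \sum_(j < N) dur j - N%:R * delta.

Let jump_window i : (i <= N)%N ->
  \sum_(j < i) dur j - i%:R * delta <= \sum_(j < i) tau j <= \sum_(j < i) dur j.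
Proof.
elim: i => [_|i IH iN]; first by rewrite !big_ord0 mul0r subr0 lexx.
have /andP[h1 h2] := IH (ltnW iN); have /andP[h3 h4] := window iN.
rewrite !big_ord_recr /= -natr1 mulrDl mul1r; apply/andP; split; lra.
Qed.

(** The [i]-th jump is early by at most [i * delta], hence by at most [sigma]. *)
Lemma plan_tube t : 0 <= t <= 1 ->
  euclidean_norm (f t - scaled_path x T t) <= e.
Proof.
move=> /andP[t0 t1]; have tT : t * T <= T by rewrite ger_pMl.
have [n nt] := locate_right tau_unbounded (mulr_ge0 t0 (ltW T_gt0)).
rewrite (scaled_pathE xE nt); have /andP[h1 h2] := nt.
have nN : (n < N)%N.
  rewrite ltnNge; apply/negP => /(jump_time_homo tau_gt0) Nn.
  have /andP[h3 _] := jump_window (leqnn N).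
  by have := le_lt_trans (le_trans (le_trans h3 Nn) (le_trans h1 tT)) covers; rewrite ltxx.
have /andP[h3 _] := jump_window (ltnW nN); have /andP[_ h4] := jump_window nN.
have := plan_ok nN (u := t * T).
rewrite /tube_ok mulfK ?gt_eqF// Zz ?(ltnW nN)//; apply.
  have nd : n%:R * delta <= sigma.
    by apply: le_trans slack; rewrite ler_wpM2r// ler_nat ltnW.
  apply/andP; split; last exact: le_trans (ltW h2) h4.
  by apply: le_trans h1; apply: le_trans h3; rewrite lerB.
by rewrite mulr_ge0// ltW.
Qed.

End FollowPlan.

Section Lattice.
Context {R : realType}.
Variable T : R.
Hypothesis T_gt0 : 0 < T.
Local Notation en := euclidean_norm.

Definition rescale (x : state) : R * R := (T^-1 * x.1%:R, T^-1 * x.2%:R).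

Definition lattice_floor (p : R * R) : state := (Num.truncn (T * p.1), Num.truncn (T * p.2)).

Lemma rescale_floor_le (p : R * R) : quadrant p ->
  (rescale (lattice_floor p)).1 <= p.1 /\ (rescale (lattice_floor p)).2 <= p.2.
Proof.
have fl (a : R) : 0 <= a -> T^-1 * (Num.truncn (T * a))%:R <= a.
  move=> a0; rewrite [leLHS]mulrC ler_pdivrMr// [leRHS]mulrC.
  by have /andP[] := Num.Theory.truncn_itv (mulr_ge0 (ltW T_gt0) a0).
by move=> [p1 p2]; split; exact: fl.
Qed.

Lemma rescale_floor_close (p : R * R) : quadrant p ->
  en (rescale (lattice_floor p) - p) <= 2 * T^-1.
Proof.
have fl (a : R) : 0 <= a -> `|T^-1 * (Num.truncn (T * a))%:R - a| <= T^-1.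
  move=> a0; have /andP[h1 h2] := Num.Theory.truncn_itv (mulr_ge0 (ltW T_gt0) a0).
  rewrite (_ : _ - a = T^-1 * ((Num.truncn (T * a))%:R - T * a)); last first.
    by field; rewrite gt_eqF.
  rewrite normrM gtr0_norm ?invr_gt0// ger_pMr ?invr_gt0//.
  rewrite distrC ger0_norm ?subr_ge0// lerBlDr addrC natr1; exact: ltW.
move=> [p1 p2]; apply: le_trans (euclidean_norm_le_add _) _ => /=.
by rewrite mulrDl mul1r lerD// fl.
Qed.

(** The distance to a corner of a box is largest at the opposite corner. A walk along
    the axes towards a centre, or away from it, therefore stays in every ball
    about that centre that contains its endpoints. *)
Lemma between_dist (x y u : state) : between x y u ->
  en (rescale u - rescale y) <= en (rescale x - rescale y) /\
  en (rescale u - rescale x) <= en (rescale y - rescale x).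
Proof.
have coord (a b c : nat) : (minn a b <= c <= maxn a b)%N ->
    `|T^-1 * c%:R - T^-1 * b%:R| <= `|T^-1 * a%:R - T^-1 * b%:R|.
  move=> /andP[h1 h2]; rewrite -!mulrBr !normrM ler_wpM2l//.
  move: h1 h2; case: (leqP a b) => ab h1 h2.
    rewrite distrC [leRHS]distrC !ger0_norm ?subr_ge0 ?ler_nat//.
    by rewrite lerD2l lerN2 ler_nat.
  by rewrite !ger0_norm ?subr_ge0 ?ler_nat ?(ltnW ab)// lerD2r ler_nat.
move=> [b1 b2]; split; apply: euclidean_norm_homo; apply: coord => //.
  by rewrite minnC maxnC.
by rewrite minnC maxnC.
Qed.

Lemma dist1_le (x y : state) (D : R) : en (rescale x - rescale y) <= D ->
  (dist1 x y)%:R <= 2 * D * T.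
Proof.
move=> xyD.
have coord (a b : nat) : ((a - b) + (b - a))%:R = T * `|T^-1 * a%:R - T^-1 * b%:R| :> R.
  rewrite -mulrBr normrM gtr0_norm ?invr_gt0// mulVKf ?gt_eqF//.
  case: (leqP a b) => ab.
    by rewrite (eqP ab) add0n natrB// distrC ger0_norm// subr_ge0 ler_nat.
  have /eqP -> : (b - a == 0)%N by rewrite subn_eq0 ltnW.
  by rewrite addn0 natrB ?(ltnW ab)// ger0_norm// subr_ge0 ler_nat ltnW.
rewrite /dist1 natrD !coord -mulrDr mulrC ler_pM2r// mulrDl mul1r.
by apply: lerD; apply: le_trans xyD; [exact: (ler_normr1 (rescale x - rescale y))|
  exact: (ler_normr2 (rescale x - rescale y))].
Qed.

Lemma cost_rescale (lambda : step -> R) (x : state) :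
  cost lambda (real_point x) = T * cost lambda (rescale x).
Proof.
by rewrite -[in RHS]cost_scale ?ltW// /rescale /= !mulrA divff ?gt_eqF// !mul1r.
Qed.

End Lattice.

Section Slots.
Context {R : realType}.
Variable lambda : step -> R.
Hypothesis lambda_gt0 : forall y, y \in steps -> 0 < lambda y.
Variable f : trajectory R.
Hypothesis Ff : F_space f.
Variables (eps eta T rho delta K : R) (n : nat) (y : nat -> R * R).
Hypothesis n_gt0 : (0 < n)%N.
Hypothesis T_gt0 : 0 < T.
Hypothesis eta_gt0 : 0 < eta.
Hypothesis eta_eps : 20 * eta <= eps.
Hypothesis T_eta : T^-1 <= eta.
Hypothesis delta_gt0 : 0 < delta.
Hypothesis rho_le : [/\ rho <= lambda (1, 0), rho <= lambda (0, 1),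
  rho <= lambda (-1, 0) & rho <= lambda (0, -1)].
Hypothesis modulus : forall s t, 0 <= s <= 1 -> 0 <= t <= 1 ->
  `|t - s| <= n%:R^-1 -> euclidean_norm (f t - f s) <= eta.
Hypothesis hop_short : 4 * eps * T * delta <= T / n%:R.
Hypothesis K_bound : forall t, 0 <= t <= 1 -> cost lambda (f t) <= K.
Hypothesis y_quadrant : forall k, (k < n)%N -> quadrant (y k).
Hypothesis y_close : forall k, (k < n)%N ->
  euclidean_norm (y k - f (k%:R / n%:R)) <= eps - 20 * eta.

Local Notation en := euclidean_norm.
Local Notation h := (total_rate lambda).
Local Notation sigma := (T / n%:R).
Local Notation ok := (tube_ok f T (eps - eta)).
Local Notation Y k := (lattice_floor T (y k)).
Local Notation H := (up_rate lambda + T * (K + cost_lip lambda * eps)).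

Let n0 : (0 : R) < n%:R. Proof. by rewrite ltr0n. Qed.
Let eps0 : 0 < eps. Proof. by apply: lt_le_trans eta_eps; rewrite mulr_gt0. Qed.
Let sigma0 : 0 < sigma. Proof. by rewrite divr_gt0. Qed.

Lemma slot_in_unit k : (k <= n)%N -> 0 <= (k%:R / n%:R : R) <= 1.
Proof. by move=> kn; rewrite divr_ge0//= ler_pdivrMr// mul1r ler_nat. Qed.

Lemma rate_le_close (u : state) s : 0 <= s <= 1 ->
  en (rescale T u - f s) <= eps -> h u <= H.
Proof.
move=> s01 us; rewrite total_rateE lerD2l.
rewrite (cost_rescale T_gt0) ler_pM2l//; apply: le_trans (cost_dist lambda_gt0 _ (f s)) _.
by rewrite lerD ?K_bound// ler_pM2l ?cost_lip_gt0.
Qed.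

(** Within one slot length of [k / n] the centre is within [eta] of [f (k / n)]. *)
Lemma close_ok k u (t : R) : (k <= n)%N ->
  en (rescale T u - f (k%:R / n%:R)) <= eps - 2 * eta ->
  k%:R * sigma - sigma <= t <= k%:R * sigma + sigma -> ok u t.
Proof.
move=> kn uk /andP[h1 h2] /andP[t0 tT].
have k01 := slot_in_unit kn.
have t01 : 0 <= t / T <= 1 by rewrite divr_ge0 ?(ltW T_gt0)//= ler_pdivrMr// mul1r.
apply: le_trans (euclidean_norm_dist _ (f (k%:R / n%:R)) _) _.
rewrite (_ : eps - eta = eta + (eps - 2 * eta)); last by ring.
apply: lerD; last by rewrite euclidean_norm_distC.
apply: modulus => //.
have tE : t / T - k%:R / n%:R = (t - k%:R * sigma) / T by field; rewrite !gt_eqF.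
rewrite tE normrM [X in _ * X]gtr0_norm ?invr_gt0// ler_pdivrMr//.
by rewrite ler_norml mulrC; apply/andP; split; lra.
Qed.

(** The walk from [x] to the target [Y k] passes through a lattice point next to
    the centre [f (k / n)]; a direct walk could leave the tube, whose sections are
    not boxes. The rest of the slot is spent in [Y k]. *)
Lemma slot_plan k N x C : (k < n)%N ->
  reach lambda rho delta sigma ok N (k%:R * sigma) x C ->
  en (rescale T x - f (k%:R / n%:R)) <= eps - 16 * eta ->
  exists m : nat, m%:R <= 4 * eps * T /\
    reach lambda rho delta sigma ok (N + m) (k.+1%:R * sigma) (Y k)
      (C + m%:R * delta * H + h (Y k) * sigma).
Proof.
move=> kn rx xk; pose A := f (k%:R / n%:R); pose F := lattice_floor T A.
have k01 := slot_in_unit (ltnW kn).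
have A0 : quadrant A by exact: F_space_quadrant.
have FA : en (rescale T F - A) <= 2 * eta.
  by apply: le_trans (rescale_floor_close T_gt0 A0) _; rewrite ler_pM2l.
have Yy : en (rescale T (Y k) - y k) <= 2 * eta.
  by apply: le_trans (rescale_floor_close T_gt0 (y_quadrant kn)) _; rewrite ler_pM2l.
have YA : en (rescale T (Y k) - A) <= eps - 18 * eta.
  apply: le_trans (euclidean_norm_dist _ (y k) _) _.
  by have := y_close kn; move: Yy; rewrite -/A; lra.
have xF : en (rescale T x - rescale T F) <= eps - 14 * eta.
  apply: le_trans (euclidean_norm_dist _ A _) _.
  by rewrite [X in _ + X]euclidean_norm_distC; move: xk FA; rewrite -/A; lra.
have YF : en (rescale T (Y k) - rescale T F) <= eps - 16 * eta.
  apply: le_trans (euclidean_norm_dist _ A _) _.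
  by rewrite [X in _ + X]euclidean_norm_distC; move: YA FA; lra.
have ball u : en (rescale T u - rescale T F) <= eps - 14 * eta ->
    en (rescale T u - A) <= eps - 2 * eta.
  move=> uF; apply: le_trans (euclidean_norm_dist _ (rescale T F) _) _.
  by move: uF FA eta_gt0; lra.
have bxF u : between x F u -> en (rescale T u - A) <= eps - 2 * eta.
  by move=> /(between_dist T)[+ _] => /le_trans h1; apply: ball; exact: h1.
have bFY u : between F (Y k) u -> en (rescale T u - A) <= eps - 2 * eta.
  move=> /(between_dist T)[_ +] => /le_trans h1; apply: ball; apply: h1.
  by apply: le_trans YF _; move: eta_gt0; lra.
have rate_H u : en (rescale T u - A) <= eps - 2 * eta -> h u <= H.
  by move=> uA; apply: (rate_le_close k01); apply: le_trans uA _; move: eta_gt0; lra.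
have m1_le : (dist1 x F)%:R <= 2 * eps * T.
  apply: dist1_le => //; apply: le_trans xF _; move: eta_gt0; lra.
have m2_le : (dist1 F (Y k))%:R <= 2 * eps * T.
  apply: dist1_le => //; rewrite euclidean_norm_distC; apply: le_trans YF _; move: eta_gt0; lra.
pose d1 : R := (dist1 x F)%:R * delta; pose d2 : R := (dist1 F (Y k))%:R * delta.
have d1_ge0 : 0 <= d1 by rewrite mulr_ge0// ltW.
have d2_ge0 : 0 <= d2 by rewrite mulr_ge0// ltW.
have d12 : d1 + d2 <= sigma.
  apply: le_trans hop_short; rewrite -mulrDl ler_pM2r//.
  by move: m1_le m2_le; lra.
have r1 : reach lambda rho delta sigma ok (N + dist1 x F) (k%:R * sigma + d1) F (C + d1 * H).
  apply: (reach_hop lambda_gt0 delta_gt0 rho_le rx _ _ (ltW sigma0)).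
    by move=> u /bxF; exact: rate_H.
  move=> u t /bxF uA /andP[h1 h2]; apply: (close_ok (ltnW kn) uA).
  by rewrite h1 (le_trans h2)// lerD2l -/d1; move: d12 d2_ge0; lra.
have {r1}r2 : reach lambda rho delta sigma ok (N + dist1 x F + dist1 F (Y k))
    (k%:R * sigma + d1 + d2) (Y k) (C + d1 * H + d2 * H).
  apply: (reach_hop lambda_gt0 delta_gt0 rho_le r1 _ _ (ltW sigma0)).
    by move=> u /bFY; exact: rate_H.
  move=> u t /bFY uA /andP[h1 h2]; apply: (close_ok (ltnW kn) uA).
  by move: h1 h2; rewrite -/d2 => h1 h2; apply/andP; split; move: d12 d1_ge0 d2_ge0; lra.
pose s := sigma - (d1 + d2).
have s0 : 0 <= s by rewrite subr_ge0.
have sE : k%:R * sigma + d1 + d2 + s = k.+1%:R * sigma.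
  by rewrite /s -natr1 mulrDl mul1r; ring.
exists (dist1 x F + dist1 F (Y k))%N; split.
  by rewrite natrD; move: m1_le m2_le; lra.
have [|z [dur [e [z0N rt okz okx cost_le]]]] := reach_wait r2 s0.
  move=> u /andP[h1 h2]; apply: (close_ok (ltnW kn)).
    by apply: le_trans YA _; move: eta_gt0; lra.
  move: h2; rewrite sE -natr1 mulrDl mul1r => h2; apply/andP; split => //.
  by move: h1 d1_ge0 d2_ge0 sigma0; lra.
rewrite addnA -sE; exists z, dur, e; split => //; apply: le_trans cost_le _.
rewrite natrD; apply: lerD.
  by rewrite le_eqVlt; apply/orP; left; apply/eqP; rewrite /d1 /d2; ring.
by rewrite ler_pM2l ?total_rate_gt0// /s lerBlDr lerDl addr_ge0.
Qed.

Lemma slots_plan k : (k <= n)%N -> exists (N : nat) (x : state) (C : R),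
  [/\ reach lambda rho delta sigma ok N (k%:R * sigma) x C,
      en (rescale T x - f (k%:R / n%:R)) <= eps - 16 * eta,
      N%:R <= k%:R * (4 * eps * T) &
      C <= N%:R * delta * H + \sum_(j < k) h (Y j) * sigma].
Proof.
elim: k => [_|k IH kn].
  have f0 : f 0 = (0, 0) by have [[_ _ _ ->] _ _] := Ff.
  have start : en (rescale T (0%N, 0%N) - f 0) = 0.
    by rewrite f0 /rescale /= !mulr0 euclidean_norm_subrr.
  exists 0%N, (0%N, 0%N), 0; rewrite !mul0r start; split => //.
  - apply: reach_start => u /andP[h1 h2]; apply: (close_ok (k := 0)) => //.
      by rewrite mul0r start; move: eta_eps eta_gt0; lra.
    by rewrite mul0r sub0r add0r h1 (le_trans h2) ?ltW.
  - by move: eta_eps eta_gt0; lra.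
  - by rewrite big_ord0 ?mul0r ?addr0.
have [N [x [C [rx xk Nk Ck]]]] := IH (ltnW kn).
have [m [m_le rY]] := slot_plan kn rx xk.
exists (N + m)%N, (Y k), (C + m%:R * delta * H + h (Y k) * sigma); split => //.
- have k01 := slot_in_unit (ltnW kn); have k01' := slot_in_unit kn.
  apply: le_trans (euclidean_norm_dist _ (f (k%:R / n%:R)) _) _.
  have h1 : en (f (k%:R / n%:R) - f (k.+1%:R / n%:R)) <= eta.
    apply: modulus => //.
    by rewrite -mulrBl -natr1 opprD addNKr mulN1r normrN gtr0_norm ?invr_gt0.
  have h2 : en (rescale T (Y k) - y k) <= 2 * eta.
    by apply: le_trans (rescale_floor_close T_gt0 (y_quadrant kn)) _; rewrite ler_pM2l.
  have h3 := euclidean_norm_dist (rescale T (Y k)) (y k) (f (k%:R / n%:R)).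
  by have := y_close kn; move: h1 h2 h3 eta_gt0; lra.
- by rewrite natrD -[k.+1%:R]natr1 mulrDl mul1r lerD.
- rewrite big_ord_recr /= natrD addrA lerD2r.
  by apply: le_trans (lerD Ck (lexx _)) _; rewrite le_eqVlt; apply/orP; left; apply/eqP; ring.
Qed.

End Slots.

Section SmallTubes.
Context {R : realType}.
Variable lambda : step -> R.
Hypothesis lambda_gt0 : forall y, y \in steps -> 0 < lambda y.
Variable f : trajectory R.
Hypothesis Ff : F_space f.

Local Notation I := (path_integral (fun t => cost lambda (f t)) 0 1).

Lemma tube_cost_le_cost eps : 0 < eps -> tube_cost lambda f eps <= I.
Proof.
move=> eps0; apply: le_Rintegral => //.
- exact: integrable_unit (min_cost_continuous lambda_gt0 Ff eps0) _ _ (lexx 0) (lexx 1).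
- exact: integrable_unit (cost_continuous lambda_gt0 Ff) _ _ (lexx 0) (lexx 1).
- move=> t /=; rewrite in_itv /= => t01; apply: min_cost_le_cost => //.
  exact: F_space_quadrant Ff _ t01.
Qed.

(** Points of a ball of radius [eps] differ in cost from its centre by at most
    [cost_lip * eps]. *)
Lemma tube_cost_ge_cost eps : 0 < eps -> I - cost_lip lambda * eps <= tube_cost lambda f eps.
Proof.
move=> eps0.
have ic := integrable_unit (cost_continuous lambda_gt0 Ff) (lexx 0) (lexx 1).
have ik := integrable_cst_segment 0 1 (cost_lip lambda * eps).
have -> : I - cost_lip lambda * eps =
    (\int[@lebesgue_measure R]_(t in `[0%R, 1%R]) (cost lambda (f t) - cost_lip lambda * eps))%R.
  rewrite RintegralB// Rintegral_cst//.
  by rewrite lebesgue_segment// subr0 mulr1.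
apply: le_Rintegral => //.
- apply: integrable_unit (lexx 0) (lexx 1).
  apply: (within_continuous_lip (F_space_continuous Ff) (cost_lip_gt0 lambda_gt0)) => x y _ _.
  by rewrite [leRHS]addrAC lerD2r; exact: cost_dist.
- exact: integrable_unit (min_cost_continuous lambda_gt0 Ff eps0) _ _ (lexx 0) (lexx 1).
- move=> t /=; rewrite in_itv /= => t01; apply: min_cost_ge_cost => //.
  exact: F_space_quadrant Ff _ t01.
Qed.

Lemma rate_functionalE : rate_functional lambda f = I%:E.
Proof.
rewrite /rate_functional asboolT//.
have ic := integrable_unit (cost_continuous lambda_gt0 Ff) (lexx 0) (lexx 1).
rewrite /path_integral /Rintegral fineK//.
exact: integrable_fin_num.
Qed.

End SmallTubes.

(** * Integrating products of functions of the sojourn times *)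

Section WeightedImage.
Local Open Scope ereal_scope.
Context d (T : measurableType d) {R : realType}.
Variables (mu : {measure set T -> \bar R}) (E : set T) (G : T -> R)
  (X : T -> R).
Hypothesis mE : measurable E.
Hypothesis mG : measurable_fun setT G.
Hypothesis G0 : forall x, (0 <= G x)%R.
Hypothesis mX : measurable_fun setT X.

Import HBNNSimple.

Let G0e x : 0 <= (G x)%:E. Proof. by rewrite lee_fin. Qed.

(** For a simple function the weighted integral only depends on the weighted measures
    of the preimages of its values. *)
Lemma integral_weighted_nnsfun (f : {nnsfun R >-> R}) :
  \int[mu]_(x in E) ((G x)%:E * (f (X x))%:E) =
  \sum_(y \in range f) (y%:E * \int[mu]_(x in E `&` X @^-1` (f @^-1` [set y])) (G x)%:E).
Proof.
have mpre (y : R) : measurable (X @^-1` (f @^-1` [set y])).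
  by rewrite -[X in measurable X]setTI; apply: mX.
have mind (y : R) : measurable_fun setT (fun x => (G x)%:E * (\1_(X @^-1` (f @^-1` [set y])) x)%:E).
  by apply: emeasurable_funM; apply/measurable_EFinP; [exact: mG|exact: measurable_indic].
have ind0 (y : R) x : 0 <= (\1_(X @^-1` (f @^-1` [set y])) x)%:E :> \bar R.
  by rewrite lee_fin indicE.
transitivity (\int[mu]_(x in E) \sum_(y \in range f)
    (y%:E * ((G x)%:E * (\1_(X @^-1` (f @^-1` [set y])) x)%:E))).
  apply: eq_integral => x _; rewrite fimfunE -fsumEFin//.
  rewrite ge0_mule_fsumr; last by move=> y; rewrite EFinM nnfun_muleindic_ge0.
  apply: eq_fsbigr => y _; rewrite EFinM muleCA; congr (_ * (_ * _)).
have y0 (y : R) : range f y -> 0 <= y%:E.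
  by move=> [z _ <-]; rewrite lee_fin.
rewrite [LHS](_ : _ = \int[mu]_(x in E) \sum_(y \in range f)
    ((Num.max 0%R y)%:E * ((G x)%:E * (\1_(X @^-1` (f @^-1` [set y])) x)%:E))); last first.
  apply: eq_integral => x _; apply: eq_fsbigr => y; rewrite inE => /y0.
  by rewrite lee_fin => yy; rewrite max_r.
have max0 (y : R) : 0 <= (Num.max 0%R y)%:E by rewrite lee_fin le_max lexx.
rewrite ge0_integral_fsum//; last 2 first.
  - move=> y; apply: emeasurable_funM; first exact: measurable_cst.
    by apply: measurable_funTS; exact: mind.
  - by move=> y x _; rewrite !mule_ge0.
apply: eq_fsbigr => y; rewrite inE => /y0 yy.
have -> : Num.max 0%R y = y by move: yy; rewrite lee_fin => yy; rewrite max_r.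
rewrite ge0_integralZl//; last 2 first.
  by apply: measurable_funTS; exact: mind.
  by move=> x _; rewrite mule_ge0.
congr (_ * _); rewrite integral_mkcondr; apply: eq_integral => x _.
by rewrite epatch_indic.
Qed.

Lemma integral_weighted_lim (g : R -> \bar R) (mg : measurable_fun setT g) :
  (forall x, 0 <= g x) ->
  \int[mu]_(x in E) ((G x)%:E * g (X x)) =
  limn (fun n => \int[mu]_(x in E)
    ((G x)%:E * (nnsfun_approx measurableT mg n (X x))%:E)).
Proof.
move=> g0; set h := nnsfun_approx _ _.
rewrite -monotone_convergence//.
- apply: eq_integral => x _; apply/esym/cvg_lim => //.
  by apply: cvgeZl => //; exact: cvg_nnsfun_approx.
- move=> n; apply: measurable_funTS; apply: emeasurable_funM; apply/measurable_EFinP => //.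
  by apply: measurableT_comp.
- by move=> n x _; rewrite mule_ge0// lee_fin.
- move=> x _ m n mn; rewrite lee_wpmul2l// lee_fin.
  exact/lefP/nd_nnsfun_approx.
Qed.

End WeightedImage.

Section Transfer.
Context {R : realType} d (T : measurableType d) d' (T' : measurableType d').
Variables (mu : {measure set T -> \bar R}) (E : set T) (G : T -> R) (X : T -> R).
Variables (nu : {measure set T' -> \bar R}) (E' : set T') (G' : T' -> R)
  (X' : T' -> R).
Hypothesis mE : measurable E.
Hypothesis mG : measurable_fun setT G.
Hypothesis G0 : forall x, 0 <= G x.
Hypothesis mX : measurable_fun setT X.
Hypothesis mE' : measurable E'.
Hypothesis mG' : measurable_fun setT G'.
Hypothesis G'0 : forall x, 0 <= G' x.
Hypothesis mX' : measurable_fun setT X'.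

Import HBNNSimple.

(** Two weighted images that agree on sets agree on functions, by simple functions
    and monotone convergence. *)
Lemma integral_weighted_transfer :
  (forall B, measurable B ->
    (\int[mu]_(x in E `&` X @^-1` B) (G x)%:E =
     \int[nu]_(x in E' `&` X' @^-1` B) (G' x)%:E)%E) ->
  forall g : R -> \bar R, measurable_fun setT g -> (forall x, (0 <= g x)%E) ->
  (\int[mu]_(x in E) ((G x)%:E * g (X x)) =
   \int[nu]_(x in E') ((G' x)%:E * g (X' x)))%E.
Proof.
move=> GG' g mg g0.
rewrite (integral_weighted_lim mu mE mG G0 mX mg g0).
rewrite (integral_weighted_lim nu mE' mG' G'0 mX' mg g0).
congr (limn _); apply/funext => n.
rewrite !integral_weighted_nnsfun//.
by apply: eq_fsbigr => y _; rewrite GG'.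
Qed.

End Transfer.

Section ExponentialMoment.
Context {R : realType}.
Notation mu := (@lebesgue_measure R).
Implicit Types (h g C : R).

Lemma exponential_prob_fin h (B : set R) : 0 < h -> measurable B ->
  exponential_prob h B = (fine (exponential_prob h B))%:E.
Proof.
move=> h0 mB; rewrite fineK// ge0_fin_numE; last first.
  by apply: integral_ge0 => x _; rewrite lee_fin exponential_pdf_ge0// ltW.
apply: (@le_lt_trans _ _ 1%E); last exact: ltry.
rewrite -(integral_exponential_pdf h0); apply: ge0_subset_integral => //.
  by apply/measurable_EFinP; exact: measurable_exponential_pdf.
by move=> x _; rewrite lee_fin exponential_pdf_ge0// ltW.
Qed.

(** Tilting by [expR (g * x)] turns the exponential density of rate [h] into a
    multiple of that of rate [h - g]. *)
Lemma exponential_moment h g C : 0 < h -> g < h -> 0 <= C ->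
  (\int[mu]_x ((C * exponential_pdf h x)%:E * (expR (g * x))%:E) =
   (C * (h / (h - g)))%:E)%E.
Proof.
move=> h0 gh C0; have hg : 0 < h - g by rewrite subr_gt0.
transitivity (\int[mu]_x ((C * (h / (h - g)))%:E * (exponential_pdf (h - g) x)%:E))%E.
  apply: eq_integral => x _; rewrite -!EFinM; congr EFin.
  case: (ltP x 0) => x0; first by rewrite !lt0_exponential_pdf// !mulr0 mul0r.
  rewrite !exponential_pdfE// -!mulrA; congr (_ * _).
  rewrite -expRD mulKf ?gt_eqF//; congr (_ * expR _); ring.
rewrite ge0_integralZl//=.
- by rewrite integral_exponential_pdf// mule1.
- by apply/measurable_EFinP; exact: measurable_exponential_pdf.
- by move=> x _; rewrite lee_fin exponential_pdf_ge0// ltW.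
- by rewrite lee_fin mulr_ge0// divr_ge0 ?ltW.
Qed.

End ExponentialMoment.

(** The density decreases, so it is bounded below by its value at the right end. *)
Lemma exponential_prob_window (R : realType) (h d delta : R) :
  0 < h -> 0 < delta -> delta <= d ->
  h * delta * expR (- (h * d)) <= fine (exponential_prob h `]d - delta, d[).
Proof.
move=> h0 delta0 dd.
rewrite -lee_fin -exponential_prob_fin//.
have -> : (h * delta * expR (- (h * d)))%:E =
   (\int[@lebesgue_measure R]_(x in `](d - delta)%R, d[) (cst (h * expR (- (h * d)))%:E x))%E.
  rewrite integral_cst//= lebesgue_measure_itv /= lte_fin ltrBlDr ltrDl delta0.
  rewrite -EFinB -EFinM; congr EFin; ring.
apply: ge0_le_integral => //.
- by move=> x _; rewrite lee_fin mulr_ge0 ?expR_ge0// ltW.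
- by apply: measurable_funTS; apply/measurable_EFinP; exact: measurable_exponential_pdf.
move=> x /=; rewrite in_itv /= => /andP[dx xd]; rewrite lee_fin.
rewrite exponential_pdfE; last first.
  by apply: ltW; apply: le_lt_trans dx; rewrite subr_ge0.
by rewrite ler_pM2l// ler_expR mulNr lerN2 ler_pM2l// ltW.
Qed.

Lemma measure_cover_le d (T : measurableType d) (R : realType)
    (mu : {measure set T -> \bar R}) (I : eqType) (s : seq I) (E : set T)
    (F : I -> set T) :
  measurable E -> (forall i, measurable (F i)) ->
  (forall w, E w -> exists2 i, i \in s & F i w) ->
  (mu E <= \sum_(i <- s) mu (F i))%E.
Proof.
move=> mE mF; elim: s E mE => [|i s IH] E mE cover.
  rewrite big_nil (_ : E = set0) ?measure0//.
  by apply/seteqP; split => w // /cover[].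
rewrite big_cons.
apply: (@le_trans _ _ (mu (F i `|` (E `\` F i)))).
  apply: le_measure; rewrite ?inE//.
  - by apply: measurableU => //; exact: measurableD.
  - by move=> w Ew; have [Fw|nFw] := pselect (F i w); [left|right].
have mD : measurable (E `\` F i) by exact: measurableD.
apply: le_trans (measureU2 _ _ _) _ => //.
apply: leeD => //; apply: IH => // w [Ew nFw].
have [j] := cover w Ew; rewrite inE => /predU1P[->//|js Fjw].
by exists j.
Qed.

Lemma nneseries_geometric_half (R : realType) (C : R) (u : nat -> \bar R) :
  0 <= C -> (forall n, (0 <= u n)%E) -> (forall n, (u n <= (C * 2^-1 ^+ n)%:E)%E) ->
  (\sum_(n <oo) u n <= (2 * C)%:E)%E.
Proof.
move=> C0 u0 uC.
apply: lime_le; first by apply: is_cvg_nneseries => n _ _; exact: u0.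
apply: nearW => n.
apply: (@le_trans _ _ (\sum_(0 <= i < n) (C * 2^-1 ^+ i)%:E)%E).
  by apply: lee_sum => i _; exact: uC.
rewrite sumEFin lee_fin -mulr_sumr mulrC ler_wpM2r//.
suff -> : \sum_(0 <= i < n) (2^-1 : R) ^+ i = 2 - 2 * 2^-1 ^+ n.
  by rewrite gerBl mulr_ge0// exprn_ge0// invr_ge0.
elim: n => [|n IH]; first by rewrite big_geq// expr0 mulr1 subrr.
by rewrite big_nat_recr//= IH exprS; field.
Qed.

Section Process.
Context {R : realType} d (Omega : measurableType d) (P : probability Omega R).
Variable lambda : step -> R.
Hypothesis lambda_gt0 : forall y, y \in steps -> 0 < lambda y.
Variables (Z : nat -> {RV P >-> state}) (tau : nat -> {RV P >-> R}).
Variable xi : R -> Omega -> state.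
Hypothesis Z0 : forall w, Z 0%N w = (0%N, 0%N).
Hypothesis tau_gt0 : forall n w, 0 < tau n w.
Hypothesis tau_unbounded : forall w (t : R), exists n, t < \sum_(i < n) tau i w.
Hypothesis xiE : forall n w (t : R),
  \sum_(i < n) tau i w <= t < \sum_(i < n.+1) tau i w -> xi t w = Z n w.
Hypothesis law : forall (n : nat) (z : nat -> state) (B : nat -> set R),
  z 0%N = (0%N, 0%N) -> (forall i, measurable (B i)) ->
  P [set w | forall i, (i < n)%N -> B i (tau i w) /\ Z i.+1 w = z i.+1] =
  (\prod_(i < n) (exponential_prob (total_rate lambda (z i)) (B i) *
                  (jump_prob lambda (z i) (z i.+1))%:E))%E.

Local Notation h := (total_rate lambda).
Local Notation p := (jump_prob lambda).

(** * The law of the process *)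

Lemma measurable_state (A : set state) : measurable A.
Proof.
apply: countable_measurable; last exact: countableP.
move=> [a b]; rewrite (_ : [set (a, b)] = [set a] `*` [set b]).
  exact: measurableX.
by apply/seteqP; split => -[u v] /= [-> ->].
Qed.

Lemma measurable_jump_time n : measurable_fun setT (fun w => \sum_(i < n) tau i w).
Proof.
rewrite (_ : (fun w => _) = (fun w => \sum_(i <- index_enum 'I_n) tau i w))//.
by apply: measurable_sum => i.
Qed.

Lemma measurable_sojourn n (t : R) :
  measurable [set w | \sum_(i < n) tau i w <= t < \sum_(i < n.+1) tau i w].
Proof.
rewrite (_ : [set w | _] = (fun w => \sum_(i < n) tau i w) @^-1` `]-oo, t]
   `&` (fun w => \sum_(i < n.+1) tau i w) @^-1` `]t, +oo[).
  apply: measurableI; rewrite -[X in measurable X]setTI;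
    exact: measurable_jump_time.
by apply/seteqP; split => w /=; rewrite !in_itv /= andbT => /andP.
Qed.

Lemma measurable_visit n (A : set state) : measurable (Z n @^-1` A).
Proof.
rewrite -[X in measurable X]setTI.
by apply: measurable_funP => //; exact: measurable_state.
Qed.

Lemma measurable_position (t : R) (A : set state) : 0 <= t ->
  measurable [set w | A (xi t w)].
Proof.
move=> t0; rewrite (_ : [set w | _] = \bigcup_n
  ([set w | \sum_(i < n) tau i w <= t < \sum_(i < n.+1) tau i w]
    `&` Z n @^-1` A)).
  apply: bigcupT_measurable => n; apply: measurableI.
    exact: measurable_sojourn.
  exact: measurable_visit.
apply/seteqP; split => w /=.
  move=> Aw; have [n nt] := @locate_right _ (fun i => tau i w) (tau_unbounded w) t t0.
  by exists n => //; split => //=; rewrite -(xiE nt).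
by move=> [n _ [nt]]; rewrite (xiE nt).
Qed.

Lemma xi0 w : xi 0 w = (0%N, 0%N).
Proof.
rewrite -(Z0 w); apply: xiE; rewrite big_ord0 lexx /= big_ord_recr big_ord0.
by rewrite /= add0r.
Qed.

Lemma scaled_process_X_space (T : R) w : 0 < T ->
  X_space (scaled_process xi T w).
Proof.
move=> T0; apply: (@scaled_path_X_space _ (fun n => Z n w) (fun n => tau n w) (fun t => xi t w)) => //.
- by move=> n t; exact: xiE.
- exact: xi0.
Qed.

(** The event is a countable combination of conditions on the position at a single
    time. *)
Lemma measurable_U_ball (f : trajectory R) (eps T : R) :
  {within `[0, 1], continuous f} -> 0 < T ->
  measurable [set w | U_ball eps f (scaled_process xi T w)].
Proof.
move=> cf T0.
pose good k (t : R) := [set w | euclidean_norm (f t - scaled_process xi T w t) <= eps - k.+1%:R^-1].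
have mgood k t : 0 <= t -> measurable (good k t).
  move=> t0; pose A : set state := [set z | euclidean_norm
    (f t - (T^-1 * z.1%:R, T^-1 * z.2%:R)) <= eps - k.+1%:R^-1].
  by apply: (@measurable_position (t * T) A); rewrite mulr_ge0// ltW.
rewrite (_ : [set w | _] = \bigcup_k (good k 1 `&` ~` \bigcup_(q : rat)
   (if 0 <= (ratr q : R) <= 1 then ~` good k (ratr q) else set0))).
  apply: bigcupT_measurable => k; apply: measurableI; first exact: mgood.
  apply: measurableC; apply: bigcupT_measurable_rat => q.
  case: ifP => // /andP[q0 _]; apply: measurableC; exact: mgood.
apply/seteqP; split => w /=.
  move=> /(U_ballP _ _ (scaled_process_X_space w T0))[k kP]; exists k => //.
  split; first by apply: kP; rewrite ler01 lexx.
  move=> [q _]; case: ifP => // q01; apply; exact: kP.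
move=> [k _ [k1 kq]]; apply/(U_ballP _ _ (scaled_process_X_space w T0)); exists k.
apply: tube_dense => //.
  apply: (@scaled_path_right _ (fun n => Z n w) (fun n => tau n w) (fun t => xi t w)) => //.
  by move=> n t; exact: xiE.
move=> q q01; apply: contrapT => nq; apply: kq; exists q => //.
by rewrite q01.
Qed.

Definition cylinder (n : nat) (z : nat -> state) (B : nat -> set R) : set Omega :=
  [set w | forall i, (i < n)%N -> B i (tau i w) /\ Z i.+1 w = z i.+1].

Lemma measurable_cylinder n z B : (forall i, measurable (B i)) ->
  measurable (cylinder n z B).
Proof.
move=> mB; rewrite (_ : cylinder n z B = \bigcap_i
  (if (i < n)%N then tau i @^-1` B i `&` Z i.+1 @^-1` [set z i.+1] else setT)).
  apply: bigcapT_measurable => i; case: ifP => // _; apply: measurableI.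
    by rewrite -[X in measurable X]setTI; exact: measurable_funP.
  exact: measurable_visit.
apply/seteqP; split => w /= H.
  by move=> i _; case: ifP => // /H.
by move=> i ni; have := H i I; rewrite ni.
Qed.

Lemma prodEFin (n : nat) (F : 'I_n -> R) :
  (\prod_(i < n) (F i)%:E)%E = (\prod_(i < n) F i)%:E.
Proof. by elim/big_ind2 : _ => // x1 x2 y1 y2 -> ->. Qed.

Lemma cylinder_prob n z B : z 0%N = (0%N, 0%N) -> (forall i, measurable (B i)) ->
  P (cylinder n z B) =
  (\prod_(i < n) (fine (exponential_prob (h (z i)) (B i)) * p (z i) (z i.+1)))%:E.
Proof.
move=> z0 mB; rewrite [LHS]law// -prodEFin; apply: eq_bigr => i _.
by rewrite (exponential_prob_fin (total_rate_gt0 lambda_gt0 _) (mB i)).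
Qed.

(** The law is given on products of sets. One sojourn after the other, the condition
    on its length is replaced by an exponential weight; [k] counts those already
    treated, whose sets have been released to the whole line. *)
Lemma cylinder_moment (n k : nat) (z : nat -> state) (g : nat -> R) (B : nat -> set R) :
  z 0%N = (0%N, 0%N) -> (forall i, (i < n)%N -> g i < h (z i)) ->
  (forall i, measurable (B i)) -> (k <= n)%N -> (forall i, (i < k)%N -> B i = setT) ->
  (\int[P]_(w in cylinder n z B) (\prod_(i < k) expR (g i * tau i w))%:E =
   (\prod_(i < n) ((if (i < k)%N then h (z i) / (h (z i) - g i)
                    else fine (exponential_prob (h (z i)) (B i)))
                   * p (z i) (z i.+1)))%:E)%E.
Proof.
move=> z0 gh; elim: k B => [|k IH] B mB kn BT.
  under eq_integral do rewrite big_ord0.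
  rewrite integral_cst ?mul1e; last exact: measurable_cylinder.
  exact: cylinder_prob.
pose G w := \prod_(i < k) expR (g i * tau i w).
pose fac (B : nat -> set R) (i : nat) := (if (i < k)%N then h (z i) / (h (z i) - g i)
                    else fine (exponential_prob (h (z i)) (B i))).
pose C := \prod_(i < n | i != Ordinal kn) (fac B i * p (z i) (z i.+1)) *
   p (z k) (z k.+1).
have hk := total_rate_gt0 lambda_gt0 (z k).
have C0 : 0 <= C.
  rewrite mulr_ge0 ?(jump_prob_ge0 lambda_gt0)// prodr_ge0// => i _.
  rewrite mulr_ge0 ?(jump_prob_ge0 lambda_gt0)// /fac; case: ifP => _.
    by rewrite divr_ge0 ?(ltW (total_rate_gt0 lambda_gt0 _))// subr_ge0 ltW// gh.
  by rewrite fine_ge0//; apply: integral_ge0 => x _;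
    rewrite lee_fin exponential_pdf_ge0// ltW// total_rate_gt0.
have mtau i : measurable_fun setT (tau i) by [].
transitivity (\int[P]_(w in cylinder n z B) ((G w)%:E * (expR (g k * tau k w))%:E))%E.
  by apply: eq_integral => w _; rewrite big_ord_recr EFinM.
rewrite (@integral_weighted_transfer _ _ _ _ _ _ (cylinder n z B) G (tau k)
  (@lebesgue_measure R) setT (fun x => C * exponential_pdf (h (z k)) x) id
  _ _ _ _ _ _ _ _ _ (fun x => (expR (g k * x))%:E))//.
- rewrite exponential_moment ?gh// (bigD1 (Ordinal kn))//= ltnSn.
  rewrite [X in _ = (_ * X)%:E](_ : _ =
    \prod_(i < n | i != Ordinal kn) (fac B i * p (z i) (z i.+1))).
    by rewrite /C; congr EFin; rewrite [LHS]mulrC [in LHS]mulrA [in LHS]mulrAC.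
  apply: eq_bigr => i ik; rewrite /fac ltnS leq_eqVlt.
  by rewrite -[X in X || _]/(i == Ordinal kn) (negbTE ik).
- exact: measurable_cylinder.
- apply: measurable_prod => i _; apply: measurableT_comp => //.
  by apply: measurable_funM => //; exact: measurable_cst.
- by move=> w; apply: prodr_ge0 => i _; exact: expR_ge0.
- by apply: measurable_funM => //; exact: measurable_exponential_pdf.
- by move=> x; rewrite mulr_ge0// exponential_pdf_ge0// ltW.
- move=> B' mB'; rewrite setTI preimage_id.
  pose B'' i := if i == k then B' else B i.
  have -> : cylinder n z B `&` tau k @^-1` B' = cylinder n z B''.
    apply/seteqP; split => w.
      by move=> [H Hk] i ni; rewrite /B''; case: eqP => [->|_]; split;
        rewrite ?(H _ ni).2 ?(H _ kn).2//; exact: (H _ ni).1.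
    move=> H; split; last by have := (H k kn).1; rewrite /B'' eqxx.
    move=> i ni; have := H i ni; rewrite /B''; case: eqP => // -> [_ ->].
    by rewrite BT.
  rewrite IH//; last 3 first.
    by move=> i; rewrite /B''; case: eqP.
    exact: ltnW.
    by move=> i ik; rewrite /B'' ltn_eqF//; apply: BT; exact: ltnW.
  under eq_integral do rewrite EFinM.
  rewrite ge0_integralZl//=.
  + rewrite -[X in (_ = _ * X)%E]/(exponential_prob (h (z k)) B').
    rewrite (exponential_prob_fin hk)// -EFinM; congr EFin.
    rewrite (bigD1 (Ordinal kn))//= ltnn /B'' eqxx /C [RHS]mulrC [in RHS]mulrA [in RHS]mulrAC.
    congr (_ * _); apply: eq_bigr => i ik; rewrite /fac; case: ifP => // _.
    by rewrite -[X in if X then _ else _]/(i == Ordinal kn) (negbTE ik).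
  + apply: measurable_funTS; apply/measurable_EFinP; exact: measurable_exponential_pdf.
  + by move=> x _; rewrite lee_fin exponential_pdf_ge0// ltW.
- by apply/measurable_EFinP; apply: measurableT_comp => //; apply: measurable_funM.
Qed.

Let exp_weight (g : nat -> R) n w := \prod_(i < n) expR (g i * tau i w).

Let measurable_exp_weight g n : measurable_fun setT (exp_weight g n).
Proof.
apply: measurable_prod => i _; apply: measurableT_comp => //.
by apply: measurable_funM => //; exact: measurable_cst.
Qed.

Let exp_weight_ge0 g n w : 0 <= exp_weight g n w.
Proof. by apply: prodr_ge0 => i _; exact: expR_ge0. Qed.

Definition redirect (z : nat -> state) (n : nat) (x : state) (i : nat) : state :=
  if i == n then x else z i.

(** There are countably many targets, each of probability zero. *)
Let exit_null N z : z 0%N = (0%N, 0%N) ->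
  P.-negligible [set w | cylinder N z (fun=> setT) w /\ Z N.+1 w \notin near_states (z N)].
Proof.
move=> z0.
pose F k : set Omega := match (unpickle k : option state) with
  | Some x => if x \in near_states (z N) then set0
              else cylinder N.+1 (redirect z N.+1 x) (fun=> setT)
  | None => set0 end.
apply: (@negligibleS _ _ _ _ (\bigcup_k F k)).
  move=> w [H ZN]; exists (pickle (Z N.+1 w)) => //.
  rewrite /F pickleK (negbTE ZN) => i; rewrite ltnS leq_eqVlt /redirect eqSS.
  by case: eqP => [->//|_ /= /H].
apply: negligible_bigcup => k; rewrite /F; case: unpickle => [x|]; last exact: negligible_set0.
case: ifPn => [_|xz]; first exact: negligible_set0.
exists (cylinder N.+1 (redirect z N.+1 x) (fun=> setT)); split => //.
  exact: measurable_cylinder.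
apply: etrans (cylinder_prob N.+1 _ _) _ => //.
rewrite big_ord_recr /=.
have -> : redirect z N.+1 x N = z N by rewrite /redirect eqn_leq ltnn andbF.
have -> : redirect z N.+1 x N.+1 = x by rewrite /redirect eqxx.
rewrite (jump_prob_far lambda xz).
have mul00 (a b : R) : a * (b * 0) = 0 by rewrite !mulr0.
by rewrite mul00.
Qed.

(** The last weight concerns a sojourn whose successor is free; summing over the
    successors uses that the jump probabilities add up to at most 1. *)
Lemma path_moment N (z : nat -> state) (g : nat -> R) :
  z 0%N = (0%N, 0%N) -> (forall i, (i <= N)%N -> g i < h (z i)) ->
  (\int[P]_(w in cylinder N z (fun=> setT)) (\prod_(i < N.+1) expR (g i * tau i w))%:E <=
   (\prod_(i < N) (h (z i) / (h (z i) - g i) * p (z i) (z i.+1))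
     * (h (z N) / (h (z N) - g N)))%:E)%E.
Proof.
move=> z0 gh.
pose D := cylinder N z (fun=> setT).
pose C x := cylinder N.+1 (redirect z N.+1 x) (fun=> setT).
pose s := near_states (z N).
have mC x : measurable (C x) by exact: measurable_cylinder.
have mf (A : set Omega) : measurable_fun A (fun w => (\prod_(i < N.+1) expR (g i * tau i w))%:E).
  by apply: measurable_funTS; apply/measurable_EFinP; exact: measurable_exp_weight.
have f0 w : (0 <= (\prod_(i < N.+1) expR (g i * tau i w))%:E)%E by rewrite lee_fin exp_weight_ge0.
pose U := \big[setU/set0]_(x <- s) C x.
have mU : measurable U by apply: bigsetU_measurable.
have [N' [mN' PN' DN']] := exit_null N z0.
rewrite -/D (@ge0_negligible_integral _ _ _ _ D N')//; last exact: measurable_cylinder.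
have mD : measurable (D `\` N').
  by apply: measurableD => //; exact: measurable_cylinder.
apply: le_trans (ge0_subset_integral P mD mU (mf _) _ _) _ => //.
  move=> w [Dw N'w]; rewrite /U -bigcup_seq.
  exists (Z N.+1 w).
    by apply: contrapT => nz; apply: N'w; apply: DN'; split => //; apply/negP.
  move=> i; rewrite ltnS leq_eqVlt /redirect eqSS.
  by case: eqP => [->//|_ /= /Dw].
rewrite ge0_integral_bigsetU//; last 2 first.
  exact: near_states_uniq.
  move=> x y _ _ [w [Cx Cy]].
  have [_] := Cx N (ltnSn _); have [_ ->] := Cy N (ltnSn _).
  by rewrite /redirect eqxx.
pose A := \prod_(i < N) (h (z i) / (h (z i) - g i) * p (z i) (z i.+1)).
have A0 : 0 <= A.
  rewrite prodr_ge0// => i _.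
  by rewrite mulr_ge0 ?(jump_prob_ge0 lambda_gt0)// divr_ge0 ?subr_ge0 ?(ltW (gh _ (ltnW (ltn_ord i))))// ltW// total_rate_gt0.
have CE x : (\int[P]_(w in C x) (\prod_(i < N.+1) expR (g i * tau i w))%:E =
    (A * (h (z N) / (h (z N) - g N)) * p (z N) x)%:E)%E.
  have rz i : (i <= N)%N -> redirect z N.+1 x i = z i.
    by rewrite /redirect; case: eqP => // ->; rewrite ltnn.
  have rz0 : redirect z N.+1 x 0 = (0%N, 0%N) by rewrite rz.
  apply: etrans (@cylinder_moment N.+1 N.+1
    (redirect z N.+1 x) g (fun=> setT) rz0 _ (fun=> measurableT) (leqnn _) _) _ => //.
    by move=> i iN; rewrite rz// gh.
  congr EFin; rewrite big_ord_recr /= ltnSn (rz N (leqnn _)) -[RHS]mulrA.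
  congr (_ * (_ * _)); last by rewrite /redirect eqxx.
  by apply: eq_bigr => i _; rewrite ltnS (ltnW (ltn_ord i)) !rz// ltnW.
rewrite (eq_bigr _ (fun x _ => CE x)) sumEFin lee_fin -mulr_sumr.
apply: ler_piMr; last by apply: sum_jump_prob_le1 => //; exact: near_states_uniq.
by rewrite mulr_ge0// divr_ge0 ?subr_ge0 ?(ltW (gh _ (leqnn _)))// ltW// total_rate_gt0.
Qed.

(** Exponential Chebyshev inequality on a single path. *)
Lemma chernoff_path N (z : nat -> state) (g : nat -> R) (A : R) (E : set Omega) :
  z 0%N = (0%N, 0%N) -> (forall i, (i <= N)%N -> g i < h (z i)) -> measurable E ->
  E `<=` cylinder N z (fun=> setT) ->
  (forall w, E w -> A <= \sum_(i < N.+1) g i * tau i w) ->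
  (P E <= (expR (- A) * (\prod_(i < N) (h (z i) / (h (z i) - g i) * p (z i) (z i.+1))
     * (h (z N) / (h (z N) - g N))))%:E)%E.
Proof.
move=> z0 gh mE EC EA.
have mf (B : set Omega) : measurable_fun B (fun w => (\prod_(i < N.+1) expR (g i * tau i w))%:E).
  by apply: measurable_funTS; apply/measurable_EFinP; exact: measurable_exp_weight.
have f0 w : (0 <= (\prod_(i < N.+1) expR (g i * tau i w))%:E)%E by rewrite lee_fin exp_weight_ge0.
have -> : P E = (\int[P]_(w in E) (cst 1%E w))%E by rewrite integral_cst// mul1e.
apply: (@le_trans _ _ (\int[P]_(w in E) ((expR (- A))%:E * (\prod_(i < N.+1) expR (g i * tau i w))%:E))%E).
  apply: ge0_le_integral => //.
    by apply: emeasurable_funM => //; exact: measurable_cst.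
  move=> w Ew; rewrite -EFinM lee_fin -expR_sum -expRD -expR0 ler_expR.
  by rewrite addrC subr_ge0 EA.
rewrite ge0_integralZl// ?lee_fin ?expR_ge0// EFinM lee_wpmul2l ?lee_fin ?expR_ge0//.
apply: le_trans _ (path_moment z0 gh).
by apply: ge0_subset_integral => //; exact: measurable_cylinder.
Qed.

(** The total rate in the density of a sojourn cancels the normalisation of the jump
    that ends it, which leaves the rate of that jump. *)
Lemma cylinder_lower (N : nat) (z : nat -> state) (dur : nat -> R) (delta rho : R) :
  z 0%N = (0%N, 0%N) -> 0 < delta -> 0 <= rho ->
  (forall i, (i < N)%N -> rho <= rate lambda (z i) (displacement (z i) (z i.+1)) /\
     delta <= dur i) ->
  (((rho * delta) ^+ N * expR (- \sum_(i < N) h (z i) * dur i))%:E <=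
   P (cylinder N z (fun i => `](dur i - delta)%R, dur i[%classic)))%E.
Proof.
move=> z0 delta0 rho0 H.
rewrite cylinder_prob// lee_fin.
rewrite -sumrN expR_sum.
have -> : (rho * delta) ^+ N = \prod_(i < N) (rho * delta).
  by rewrite prodr_const card_ord.
rewrite -big_split /=; apply: ler_prod => i _.
have [Hr Hd] := H i (ltn_ord i).
have h0 := total_rate_gt0 lambda_gt0 (z i).
apply/andP; split; first by rewrite !mulr_ge0 ?expR_ge0// ltW.
apply: (@le_trans _ _ (h (z i) * delta * expR (- (h (z i) * dur i)) * jump_prob lambda (z i) (z i.+1))).
  rewrite /jump_prob.
  have -> : h (z i) * delta * expR (- (h (z i) * dur i)) *
    (rate lambda (z i) ((z i.+1).1%:Z - (z i).1%:Z, (z i.+1).2%:Z - (z i).2%:Z) / h (z i)) =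
    rate lambda (z i) (displacement (z i) (z i.+1)) * delta * expR (- (h (z i) * dur i)).
    by rewrite /displacement; field; rewrite gt_eqF.
  by rewrite ler_pM2r ?expR_gt0// ler_pM2r.
by rewrite ler_wpM2r ?jump_prob_ge0// exponential_prob_window.
Qed.

(** * Upper bound *)

Section UpperBound.
Variable f : trajectory R.
Hypothesis Ff : F_space f.
Variables (eps T K a : R).
Hypothesis eps_gt0 : 0 < eps.
Hypothesis T_gt0 : 0 < T.
Hypothesis a_ge1 : 1 <= a.
Hypothesis K_bound : forall (z : state) (t : R), 0 <= t <= 1 ->
  euclidean_norm (f t - (T^-1 * z.1%:R, T^-1 * z.2%:R)) < eps ->
  cost lambda (real_point z) <= K.

Local Notation Lam := (up_rate lambda).
Local Notation A := [set w | U_ball eps f (scaled_process xi T w)].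
Local Notation c z := (cost lambda (real_point z)).

(* Twice the rate of [sum_path_weight], so that every further jump halves the bound. *)
Let beta := 2 * (Lam * a + K / a).
Let q := Lam + beta.
Let Phi := tube_cost lambda f eps.

Let a0 : 0 < a. Proof. exact: lt_le_trans a_ge1. Qed.

Let c_ge0 z : 0 <= c z.
Proof. by rewrite cost_ge0//; exact: quadrant_real_point. Qed.

Let c0_le : c (0%N, 0%N) <= K.
Proof.
apply: (K_bound (t := 0)); first by rewrite lexx ler01.
have [[_ _ _ f0] _ _] := Ff.
by rewrite f0 !mulr0 euclidean_norm_subrr.
Qed.

Let K0 : 0 <= K. Proof. exact: le_trans c0_le. Qed.

Let Lam0 : 0 < Lam. Proof. exact: up_rate_gt0. Qed.

Let beta0 : 0 <= beta.
Proof. by rewrite mulr_ge0// addr_ge0// ?divr_ge0 ?mulr_ge0 ?(ltW Lam0)// ltW. Qed.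

Let q0 : 0 < q. Proof. by rewrite ltr_wpDr. Qed.

Let ratio_le : (Lam * a + K / a) / q <= 2^-1.
Proof.
rewrite ler_pdivrMr// /q /beta.
have : 0 <= Lam * a + K / a by rewrite addr_ge0 ?divr_ge0 ?mulr_ge0 ?(ltW Lam0) ?(ltW a0).
by move: Lam0; lra.
Qed.

Let mA : measurable A.
Proof.
exact: (measurable_U_ball eps (F_space_continuous Ff) T_gt0).
Qed.

Let tube_w w : A w -> forall t, 0 <= t <= 1 ->
  euclidean_norm (f t - scaled_path (fun u => xi u w) T t) < eps.
Proof.
move=> Aw t t01.
have /(U_ballP _ _ (scaled_process_X_space w T_gt0)) := Aw.
move=> [k kP]; apply: le_lt_trans (kP t t01) _.
by rewrite ltrBlDr ltrDl invr_gt0.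
Qed.

Let during N := [set w | \sum_(i < N) tau i w <= T < \sum_(i < N.+1) tau i w].

Let pathz (s : seq state) (i : nat) := nth (0%N, 0%N) ((0%N, 0%N) :: s) i.

Let factor := expR (beta * T - T ^+ 2 * Phi) * ((Lam + K) / Lam).

Let path_bound (b : seq state) N s : (forall z, z \in b -> c z <= K) ->
  s \in paths b N ->
  (P (A `&` during N `&` cylinder N (pathz s) (fun=> setT)) <=
   (factor * path_weight lambda q (0%N, 0%N) s)%:E)%E.
Proof.
move=> bK sN; have sizes := size_paths sN; have sb := paths_box sN.
have pathK i : (i <= N)%N -> c (pathz s i) <= K.
  case: i => [|i] iN; first exact: c0_le.
  by apply: bK; move/allP : sb; apply; rewrite /pathz /= mem_nth ?sizes.
(* The tilt removes the cost from each total rate. Completed sojourns, whose sum is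
   at most [T], are damped by [beta] as well; the sojourn containing [T] is not,
   since it may extend far beyond [T]. *)
pose g i := if (i < N)%N then c (pathz s i) - beta else c (pathz s i).
have gh i : (i <= N)%N -> g i < h (pathz s i).
  move=> _; rewrite /g total_rateE; case: ifP => _; move: Lam0 beta0; lra.
have mE : measurable (A `&` during N `&` cylinder N (pathz s) (fun=> setT)).
  apply: measurableI; first by apply: measurableI => //; exact: measurable_sojourn.
  exact: measurable_cylinder.
apply: le_trans (@chernoff_path N (pathz s) g
   (T ^+ 2 * Phi - beta * T) _ _ gh mE _ _) _ => //.
- move=> w [[Aw /andP[NT TN]] Cw].
  have Zw i : (i <= N)%N -> Z i w = pathz s i.
    by case: i => [|i] iN; [rewrite Z0|case: (Cw i iN)].
  have := @tube_cost_le _ _ lambda_gt0 _ Ff (fun i => Z i w) (fun i => tau i w)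
     (fun t => xi t w) _ _ T_gt0 eps_gt0 (fun n => tau_gt0 n w)
     (fun n t => @xiE n w t) (tube_w Aw) N NT TN.
  rewrite -/Phi => HPhi.
  apply: (@le_trans _ _ (\sum_(i < N.+1) c (Z i w) * tau i w - beta * \sum_(i < N) tau i w)).
    by apply: lerB => //; exact: ler_wpM2l.
  rewrite !big_ord_recr /= {2}/g ltnn Zw// addrAC lerD2r.
  rewrite mulr_sumr -sumrB; apply: ler_sum => i _.
  by rewrite Zw ?(ltnW (ltn_ord i))// /g ltn_ord -mulrBl.
- have prodE : \prod_(i < N) (h (pathz s i) / (h (pathz s i) - g i) *
      jump_prob lambda (pathz s i) (pathz s i.+1)) = path_weight lambda q (0%N, 0%N) s.
    rewrite (path_weightE _ _ _ _ (0%N, 0%N)) sizes; apply: eq_bigr => i _.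
    rewrite /g ltn_ord /jump_prob {1 2}total_rateE.
    have -> : Lam + c (pathz s i) - (c (pathz s i) - beta) = q by rewrite /q; ring.
    rewrite -total_rateE.
    have h0 : h (pathz s i) != 0 by rewrite gt_eqF// total_rate_gt0.
    rewrite mulrAC [h _ * _]mulrC divfK//.
  rewrite lee_fin opprB /factor prodE -!mulrA ler_wpM2l ?expR_ge0//.
  rewrite [leRHS]mulrA [leRHS]mulrC ler_wpM2l ?path_weight_ge0//.
  have -> : h (pathz s N) - g N = Lam by rewrite /g ltnn total_rateE; ring.
  by rewrite ler_pM2r ?invr_gt0// total_rateE lerD2l pathK.
Qed.

(** Decompose by the number of jumps before [T] and by the path that is followed. The
    path bounds sum to a term that is halved by each further jump. *)
Lemma tube_prob_le : (P A <= (2 * factor)%:E)%E.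
Proof.
have [b [b_uniq bP]] := cost_box lambda_gt0 K.
have bK z : z \in b -> c z <= K by rewrite bP.
have factor0 : 0 <= factor.
  by apply: mulr_ge0; [exact: expR_ge0|apply: divr_ge0; [exact: addr_ge0 (ltW Lam0) K0|exact: ltW]].
have mE N : measurable (A `&` during N).
  by apply: measurableI => //; exact: measurable_sojourn.
have Ebound N : (P (A `&` during N) <= (factor * 2^-1 ^+ N)%:E)%E.
  apply: le_trans (@measure_cover_le _ _ _ P _ (paths b N) _
    (fun s => A `&` during N `&` cylinder N (pathz s) (fun=> setT)) _ _ _) _ => //.
  - by move=> s; apply: measurableI => //; exact: measurable_cylinder.
  - move=> w [Aw Nw].
    pose s := [seq Z i.+1 w | i <- iota 0 N].
    have ss : size s = N by rewrite size_map size_iota.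
    exists s; last first.
      split => // i iN; split => //.
      by rewrite /pathz /= (nth_map 0%N) ?size_iota// nth_iota.
    rewrite -ss; apply: mem_paths; apply/allP => _ /mapP[i iN ->].
    move: iN; rewrite mem_iota add0n => iN; rewrite bP.
    have /andP[NT _] := Nw.
    have iT : \sum_(j < i.+1) tau j w <= T.
      by apply: le_trans NT; apply: (@jump_time_homo _ (fun j => tau j w)).
    have i0 : 0 <= \sum_(j < i.+1) tau j w by rewrite sumr_ge0// => j _; rewrite ltW.
    apply: (K_bound (t := (\sum_(j < i.+1) tau j w) / T)).
      by rewrite divr_ge0 ?(ltW T_gt0)//= ler_pdivrMr ?mul1r.
    have := tube_w Aw (t := (\sum_(j < i.+1) tau j w) / T).
    rewrite (@scaled_pathE _ (fun n => Z n w) (fun n => tau n w) _ _ _ i.+1).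
    + by apply; rewrite divr_ge0 ?(ltW T_gt0)//= ler_pdivrMr ?mul1r.
    + by move=> n t; exact: xiE.
    + by rewrite divfK ?gt_eqF// lexx /= (@jump_time_lt _ (fun j => tau j w)).
  apply: (@le_trans _ _ (\sum_(s <- paths b N) (factor * path_weight lambda q (0%N, 0%N) s)%:E)%E).
    rewrite big_seq [leRHS]big_seq; apply: lee_sum => s sN; exact: path_bound sN.
  rewrite sumEFin lee_fin -mulr_sumr ler_wpM2l//.
  apply: le_trans (sum_path_weight lambda_gt0 a_ge1 q0 b_uniq bK N c0_le) _.
  rewrite /level /= expr0 mulr1 lerXn2r// nnegrE ?invr_ge0//.
  apply: divr_ge0; last exact: ltW.
  by apply: addr_ge0; [apply: mulr_ge0; exact: ltW|apply: divr_ge0 => //; exact: ltW].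
apply: (@le_trans _ _ (\sum_(N <oo) P (A `&` during N))%E).
  apply: (@measure_sigma_subadditive _ _ _ P) => //.
  move=> w Aw; have [N NT] := @locate_right _ (fun i => tau i w) (tau_unbounded w) T (ltW T_gt0).
  by exists N.
by apply: nneseries_geometric_half.
Qed.

End UpperBound.

(** * Lower bound *)

Section PlanProbability.
Variable f : trajectory R.
Hypothesis cf : {within `[0, 1], continuous f}.
Variables (eps T e rho delta sigma : R).
Hypothesis T_gt0 : 0 < T.
Hypothesis e_lt : e < eps.
Hypothesis delta_gt0 : 0 < delta.
Hypothesis rho_ge0 : 0 <= rho.
Hypothesis rho_le : rho <= lambda (1, 0).

(** One more jump, upwards, ends the last sojourn after the horizon has passed. *)
Lemma reach_prob N D x C :
  reach lambda rho delta sigma (tube_ok f T e) N D x C ->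
  N.+1%:R * delta <= sigma -> T < D - sigma ->
  (((rho * delta) ^+ N.+1 * expR (- (C + total_rate lambda x * delta)))%:E <=
   P [set w | U_ball eps f (scaled_process xi T w)])%E.
Proof.
move=> rx Nsigma TD.
have sigma0 : 0 <= sigma by apply: le_trans Nsigma; rewrite mulr_ge0// ltW.
have [|u /andP[Du _] /andP[_ uT]|z [dur [[z0 _] rt okz DN cost_le]]] :=
    reach_commit (x' := (x.1.+1, x.2)) rx.
- rewrite (_ : displacement _ _ = (1, 0)) ?/rate//.
  by rewrite /displacement /=; congr pair; clear; lia.
- by exfalso; move: (le_lt_trans (le_trans Du uT) TD); rewrite ltNge => /negP; apply; lra.
have mA := measurable_U_ball eps cf T_gt0.
apply: le_trans (le_trans (cylinder_lower z0 delta_gt0 rho_ge0 rt) _).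
  rewrite lee_fin ler_wpM2l ?exprn_ge0 ?mulr_ge0 ?(ltW delta_gt0)//.
  by rewrite ler_expR lerN2.
apply: le_measure; rewrite ?inE//; first exact: measurable_cylinder.
move=> w Cw; split; first exact: (scaled_process_X_space).
apply: (@le_lt_trans _ _ e%:E); last by rewrite lte_fin.
apply: ge_ereal_sup => _ [t /= t01 <-]; rewrite lee_fin.
rewrite in_itv /= in t01.
apply: (plan_tube (Z := fun n => Z n w) (z := z) (tau := fun n => tau n w) (dur := dur)
  (x := fun u => xi u w) (delta := delta) (sigma := sigma) (N := N.+1)) => //.
- by move=> n u; exact: xiE.
- exact: ltW.
- by case=> [|i] iN; rewrite ?Z0 ?z0//; case: (Cw i iN).
- by move=> i iN; have [+ _] := Cw i iN; rewrite /= in_itv.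
- by rewrite DN; apply: lt_le_trans TD _; rewrite -addrA lerD2l lerBrDl; move: delta_gt0 Nsigma; lra.
Qed.

End PlanProbability.

Section LowerBound.
Variable f : trajectory R.
Hypothesis Ff : F_space f.
Variables (eps kappa : R).
Hypothesis eps_gt0 : 0 < eps.
Hypothesis kappa_gt0 : 0 < kappa.

Local Notation cL := (cost_lip lambda).
Local Notation Lam := (up_rate lambda).
Local Notation en := euclidean_norm.

(** The plan of [slots_plan], prolonged beyond [T]. Its cost is a Riemann sum of
    [T ^+ 2 * min_cost] up to errors that are small multiples of [T ^+ 2]. *)
Lemma tube_prob_ge : exists (B T0 : R), 0 < T0 /\ forall T, T0 <= T ->
  ((expR (- (T ^+ 2 * (tube_cost lambda f eps + kappa) + B * T)))%:E <=
   P [set w | U_ball eps f (scaled_process xi T w)])%E.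
Proof.
have cL0 := cost_lip_gt0 lambda_gt0.
have Lam0 := up_rate_gt0 lambda_gt0.
have [K K0 Kb] := cost_bounded lambda_gt0 Ff.
pose K' := K + cL * eps.
have K'0 : 0 < K' by rewrite ltr_wpDl// mulr_gt0.
(* The margin of [20 * eta] covers roundings to the lattice, [2 * eta] each, and the
   motion of the centre, [eta] per slot. *)
pose eta := Num.min (eps / 20) (kappa / (42 * (cL + 1))).
have cL1 : 0 < 42 * (cL + 1) by apply: mulr_gt0 => //; exact: addr_gt0 cL0 ltr01.
have eta0 : 0 < eta by rewrite lt_min !divr_gt0.
have eta_eps : 20 * eta <= eps.
  by rewrite mulrC -ler_pdivlMr// ge_min lexx.
have eta_kappa : 21 * (cL + 1) * eta <= kappa / 2.
  have : eta <= kappa / (42 * (cL + 1)) by rewrite ge_min lexx orbT.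
  rewrite ler_pdivlMr// => hh.
  by rewrite ler_pdivlMr//; apply: le_trans hh; rewrite le_eqVlt; apply/orP; left; apply/eqP; ring.
have [r r0 rP] := uniform_modulus (F_space_continuous Ff) eta0.
(* Slots shorter than the modulus of continuity, and so many that the walks and the
   prolongation beyond [T] cost at most [T ^+ 2 * kappa / 2]. *)
pose n := (Num.bound (r^-1 + 8 * K' / kappa)).+1.
have n0 : (0 : R) < n%:R by rewrite ltr0n.
have nb : r^-1 + 8 * K' / kappa < n%:R.
  apply: lt_le_trans (archi_boundP _) _; last by rewrite ler_nat.
  by rewrite addr_ge0 ?invr_ge0 ?divr_ge0 ?mulr_ge0// ltW.
have q0 : 0 <= 8 * K' / kappa by rewrite divr_ge0 ?mulr_ge0// ltW.
have rn : n%:R^-1 < r.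
  rewrite invf_plt ?posrE//; apply: le_lt_trans nb; lra.
have Kn : 4 * K' / n%:R <= kappa / 2.
  have ir : 0 < r^-1 by rewrite invr_gt0.
  have : 8 * K' / kappa <= n%:R by lra.
  rewrite ler_pdivrMr// => hh; rewrite ler_pdivrMr//; lra.
have modulus s t : 0 <= s <= 1 -> 0 <= t <= 1 -> `|t - s| <= n%:R^-1 -> en (f t - f s) <= eta.
  by move=> s01 t01 st; apply: rP => //; exact: le_lt_trans rn.
have ychoice k : exists yk, (k < n)%N -> [/\ quadrant yk,
    en (yk - f (k%:R / n%:R)) <= eps - 20 * eta &
    cost lambda yk <= min_cost lambda eps (f (k%:R / n%:R)) + (cL + 1) * (20 * eta)].
  have [kn|kn] := ltnP k n; last by exists 0 => //.
  have k01 := slot_in_unit (R := R) (isT : (0 < n)%N) (ltnW kn).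
  have [yk ykP] := min_cost_inner lambda_gt0 (mulr_gt0 (ltr0n _ 20) eta0 : 0 < 20 * eta)
    eta_eps (F_space_quadrant Ff k01).
  by exists yk.
have [y yP] := choice ychoice.
(* Independent of [T]. The walks of all slots then take half a slot in total, and
   the factor [(rho * delta) ^+ N], with [N] of order [T], is negligible. *)
pose delta := (8 * eps * n%:R ^+ 2)^-1.
have delta0 : 0 < delta by rewrite invr_gt0 !mulr_gt0// exprn_gt0.
pose rho := Num.min (Num.min (lambda (1, 0)) (lambda (0, 1)))
  (Num.min (lambda (-1, 0)) (lambda (0, -1))).
have rho0 : 0 < rho.
  by rewrite !lt_min !lambda_right_gt0 ?lambda_up_gt0 ?lambda_left_gt0 ?lambda_down_gt0.
have rho_le : [/\ rho <= lambda (1, 0), rho <= lambda (0, 1),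
    rho <= lambda (-1, 0) & rho <= lambda (0, -1)].
  by split; rewrite !ge_min lexx ?orbT.
pose L := `|ln (rho * delta)|.
pose B := 5 * Lam + (4 * eps * n%:R + 1) * L.
pose T0 := 1 + eta^-1 + 2 * n%:R * delta.
have ieta : 0 < eta^-1 by rewrite invr_gt0.
have nd : 0 < 2 * n%:R * delta by apply: mulr_gt0 => //; exact: mulr_gt0.
have T00 : 0 < T0 by rewrite /T0; lra.
exists B, T0; split => // T T0T.
have T_gt0 : 0 < T by exact: lt_le_trans T0T.
have T1 : 1 <= T by apply: le_trans T0T; rewrite /T0; lra.
have T_eta : T^-1 <= eta.
  by rewrite invf_ple ?posrE//; apply: le_trans T0T; rewrite /T0; lra.
pose sigma := T / n%:R.
have sigma0 : 0 < sigma by rewrite divr_gt0.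
have n_ge1 : (1 : R) <= n%:R by rewrite ler1n.
have hopE : n%:R * (4 * eps * T) * delta = sigma / 2.
  by rewrite /delta /sigma; field; rewrite !gt_eqF.
have hop_short : 4 * eps * T * delta <= T / n%:R.
  apply: (@le_trans _ _ (sigma / 2)); last by rewrite -/sigma; lra.
  rewrite -hopE ler_pM2r// ler_peMl// !mulr_ge0// ltW//.
have delta_sigma : delta <= sigma / 2.
  rewrite ler_pdivlMr// /sigma ler_pdivlMr//.
  by apply: le_trans T0T; rewrite /T0; lra.
have [N [x [C [rx xk Nk Ck]]]] := slots_plan lambda_gt0 Ff (isT : (0 < n)%N) T_gt0 eta0
  eta_eps T_eta delta0 rho_le modulus hop_short Kb (fun k kn => (let: And3 a _ _ := yP k kn in a))
  (fun k kn => (let: And3 _ a _ := yP k kn in a)) (leqnn n).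
pose H := Lam + T * K'.
have H0 : 0 < H by rewrite addr_gt0// mulr_gt0.
have nsigma : n%:R * sigma = T by rewrite /sigma mulrC divfK ?gt_eqF.
have one01 : 0 <= (n%:R / n%:R : R) <= 1 by rewrite divff ?gt_eqF// ler01 lexx.
have hx : h x <= H.
  apply: (rate_le_close lambda_gt0 T_gt0 Kb one01).
  by apply: le_trans xk _; lra.
have wait : reach lambda rho delta sigma (tube_ok f T (eps - eta)) N
    (n%:R * sigma + 2 * sigma) x (C + h x * (2 * sigma)).
  apply: reach_wait rx _ _; first by rewrite mulr_ge0// ltW.
  move=> u /andP[Tu _] u0T; have /andP[_ uT] := u0T.
  apply: (@close_ok _ f eps eta T n isT T_gt0 modulus n x u (leqnn n) _ _ u0T).
    by apply: le_trans xk _; lra.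
  by rewrite -/sigma nsigma; apply/andP; split; rewrite nsigma in Tu; lra.
have Nd : N%:R * delta <= sigma / 2.
  by rewrite -hopE ler_pM2r.
have e_lt : eps - eta < eps by rewrite gtrBl.
have Nd' : N.+1%:R * delta <= sigma by rewrite -natr1 mulrDl mul1r; lra.
have TD : T < n%:R * sigma + 2 * sigma - sigma by rewrite nsigma; lra.
have [rho_le1 _ _ _] := rho_le.
apply: le_trans (reach_prob
  (F_space_continuous Ff) T_gt0 e_lt delta0 (ltW rho0) rho_le1 wait Nd' TD).
rewrite lee_fin.
have rd0 : 0 < rho * delta by exact: mulr_gt0.
rewrite -{1}(lnK (rd0 : rho * delta \is Num.pos)) -expRM_natl -expRD ler_expR.
pose Phi := tube_cost lambda f eps.
pose m j := min_cost lambda eps (f (j%:R / n%:R)).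
have Hsigma : H * sigma <= Lam * T + T ^+ 2 * (K' / n%:R).
  rewrite /H /sigma mulrDl; apply: lerD; last first.
    by rewrite le_eqVlt; apply/orP; left; apply/eqP; ring.
  by rewrite ler_pM2l// ler_pdivrMr// ler_peMr// ltW.
have hops : N%:R * delta * H <= sigma / 2 * H by rewrite ler_pM2r.
have stay : h x * (2 * sigma) + h x * delta <= H * (5 / 2 * sigma).
  rewrite -mulrDr; apply: ler_pM => //; first exact/ltW/total_rate_gt0.
    by rewrite addr_ge0 ?mulr_ge0 ?(ltW sigma0)// ltW.
  lra.
have slots : \sum_(j < n) h (lattice_floor T (y j)) * sigma <=
    Lam * T + T ^+ 2 * (Phi + cL * eta + (cL + 1) * (20 * eta)).
  apply: (@le_trans _ _ (\sum_(j < n) (Lam * sigma +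
      T ^+ 2 * (m j / n%:R + (cL + 1) * (20 * eta) / n%:R)))).
    apply: ler_sum => j _; have [yq _ yc] := yP j (ltn_ord j).
    rewrite total_rateE mulrDl lerD2l.
    rewrite (cost_rescale T_gt0).
    have [h1 h2] := rescale_floor_le T_gt0 yq.
    have h3 := le_trans (cost_homo lambda_gt0 h1 h2) yc.
    have -> : T ^+ 2 * (m j / n%:R + (cL + 1) * (20 * eta) / n%:R) =
        T * (m j + (cL + 1) * (20 * eta)) * sigma by rewrite /sigma; ring.
    by rewrite ler_pM2r// ler_pM2l.
  rewrite big_split /= sumr_const card_ord -mulr_sumr.
  apply: lerD.
    by rewrite -mulr_natl mulrCA nsigma.
  rewrite ler_pM2l ?exprn_gt0// big_split /= sumr_const card_ord.
  apply: lerD; first exact: (riemann_sum_le lambda_gt0 Ff (isT : (0 < n)%N) eps_gt0 modulus).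
  by rewrite -[leLHS]mulr_natr divfK ?gt_eqF.
have logs : - ((4 * eps * n%:R + 1) * T * L) <= N.+1%:R * ln (rho * delta).
  have L0 : 0 <= L by exact: normr_ge0.
  apply: (@le_trans _ _ (- (N.+1%:R * L))).
    rewrite lerN2 ler_wpM2r// -natr1; move: Nk T1; lra.
  rewrite -mulrN ler_pM2l ?ltr0n// lerNl.
  by rewrite /L -normrN; exact: ler_norm.
have quad : T ^+ 2 * (Phi + cL * eta + (cL + 1) * (20 * eta)) + 3 * (T ^+ 2 * (K' / n%:R))
    <= T ^+ 2 * (Phi + kappa).
  have -> : 3 * (T ^+ 2 * (K' / n%:R)) = T ^+ 2 * (3 * (K' / n%:R)) by ring.
  rewrite -[leLHS]mulrDr ler_pM2l ?exprn_gt0//.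
  have : 0 < K' / n%:R by rewrite divr_gt0.
  move: eta_kappa Kn; rewrite -mulrA => *; lra.
have LT : 0 < Lam * T by rewrite mulr_gt0.
rewrite -/Phi /B mulrDl [_ * L * T]mulrAC.
move: Ck; rewrite -/sigma -/H => Ck.
lra.
Qed.

End LowerBound.

(** * Limits *)

Section Limits.
Variable f : trajectory R.
Hypothesis Ff : F_space f.
Variable eps : R.
Hypothesis eps_gt0 : 0 < eps.

Local Notation cL := (cost_lip lambda).
Local Notation Lam := (up_rate lambda).
Local Notation Phi := (tube_cost lambda f eps).

Lemma tube_prob_le_expR kappa : 0 < kappa -> exists (B T0 : R), 0 < T0 /\ forall T, T0 <= T ->
  (P [set w | U_ball eps f (scaled_process xi T w)] <=
   (expR (- (T ^+ 2 * (Phi - kappa)) + B * T))%:E)%E.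
Proof.
move=> kappa0.
have cL0 := cost_lip_gt0 lambda_gt0.
have Lam0 := up_rate_gt0 lambda_gt0.
have [K K0 Kb] := cost_bounded lambda_gt0 Ff.
pose K' := K + cL * eps.
have K'0 : 0 < K' by rewrite ltr_wpDl// mulr_gt0.
(* A large [a] makes the contribution of the downward jumps at most
   [T ^+ 2 * kappa]; that of the upward jumps remains of order [T]. *)
pose a := 1 + 2 * K' / kappa.
have a1 : 1 <= a by rewrite lerDl divr_ge0 ?mulr_ge0// ltW.
have a0 : 0 < a by exact: lt_le_trans a1.
have aK : 2 * K' / a <= kappa.
  rewrite ler_pdivrMr// (_ : kappa * a = kappa + 2 * K'); last first.
    by rewrite /a; field; rewrite gt_eqF.
  by rewrite lerDr ltW.
exists (2 * Lam * a + (2 + 2 * K' / Lam)), 1; split => // T T1.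
have T_gt0 : 0 < T by exact: lt_le_trans T1.
have Kbound (z : state) (t : R) : 0 <= t <= 1 ->
    euclidean_norm (f t - (T^-1 * z.1%:R, T^-1 * z.2%:R)) < eps ->
    cost lambda (real_point z) <= T * K'.
  move=> t01 zt; rewrite -(lerD2l Lam) -total_rateE.
  apply: (rate_le_close lambda_gt0 T_gt0 Kb t01).
  by rewrite euclidean_norm_distC ltW.
apply: le_trans (tube_prob_le Ff
  eps_gt0 T_gt0 a1 Kbound) _.
rewrite lee_fin mulrCA.
have pre : 2 * ((Lam + T * K') / Lam) <= expR ((2 + 2 * K' / Lam) * T).
  apply: (@le_trans _ _ (2 + 2 * K' / Lam * T)).
    by rewrite le_eqVlt; apply/orP; left; apply/eqP; field; rewrite gt_eqF.
  apply: (@le_trans _ _ (1 + (2 + 2 * K' / Lam) * T)); last exact: expR_ge1Dx.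
  by rewrite mulrDl; move: T1; lra.
apply: le_trans (ler_wpM2l (expR_ge0 _) pre) _.
rewrite -expRD ler_expR.
have TaK : T ^+ 2 * (2 * K' / a) <= T ^+ 2 * kappa by rewrite ler_pM2l ?exprn_gt0.
have -> : 2 * (Lam * a + T * K' / a) * T = 2 * Lam * a * T + T ^+ 2 * (2 * K' / a) by ring.
rewrite mulrBr [(2 * Lam * a + _) * T]mulrDl; lra.
Qed.

Lemma scaled_log_prob_bounds e : 0 < e -> exists2 T0, 0 < T0 & forall T, T0 <= T ->
  exists2 r : R, scaled_log_prob P xi f eps T = r%:E & `|- Phi - r| <= e.
Proof.
move=> e0; have e2 : 0 < e / 2 by rewrite divr_gt0.
have [B1 [T1 [T10 H1]]] := tube_prob_le_expR e2.
have [B2 [T2 [T20 H2]]] := tube_prob_ge Ff eps_gt0 e2.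
pose B := `|B1| + `|B2|.
have B0 : 0 <= B by rewrite addr_ge0.
exists (T1 + T2 + 2 * B / e); first by rewrite ltr_wpDr ?addr_gt0// divr_ge0 ?mulr_ge0// ltW.
move=> T TT.
have q0 : 0 <= 2 * B / e by rewrite divr_ge0 ?mulr_ge0// ltW.
have T_gt0 : 0 < T by lra.
have /H1 {}H1 : T1 <= T by lra.
have /H2 {}H2 : T2 <= T by lra.
have BT : B * T <= T ^+ 2 * (e / 2).
  have : 2 * B / e <= T by lra.
  rewrite ler_pdivrMr// => h; rewrite expr2 -mulrA mulrC ler_pM2l//; lra.
have b1 : B1 * T <= B * T.
  by rewrite ler_pM2r// /B (le_trans (ler_norm _))// lerDl.
have b2 : B2 * T <= B * T.
  by rewrite ler_pM2r// /B (le_trans (ler_norm _))// lerDr.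
rewrite /scaled_log_prob; move: H1 H2.
set p := P _; case: p => [p| |]//; rewrite !lee_fin => H1 H2.
have p0 : 0 < p by apply: lt_le_trans (expR_gt0 _) H2.
exists (T ^- 2 * ln p); first by rewrite lne_EFin.
have l1 : ln p <= - (T ^+ 2 * (Phi - e / 2)) + B1 * T.
  by rewrite -ler_expR lnK.
have l2 : - (T ^+ 2 * (Phi + e / 2) + B2 * T) <= ln p.
  by rewrite -ler_expR lnK.
have T2_gt0 : 0 < T ^+ 2 by rewrite exprn_gt0.
have -> : - Phi - T ^- 2 * ln p = T ^- 2 * (- (T ^+ 2 * Phi) - ln p).
  by field; rewrite gt_eqF.
rewrite normrM gtr0_norm ?invr_gt0// mulrC ler_pdivrMr// ler_norml.
by apply/andP; split; rewrite mulrDr in l2; rewrite mulrBr in l1; lra.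
Qed.

Lemma scaled_log_prob_cvg :
  scaled_log_prob P xi f eps T @[T --> +oo] --> (- Phi)%:E.
Proof.
apply/fine_cvgP; split.
  have [T0 T00 TP] := scaled_log_prob_bounds ltr01.
  near=> T; have [|r -> _] := TP T; last by [].
  by near: T; apply: nbhs_pinfty_ge; exact: num_real.
apply/cvgrPdist_le => e e0.
have [T0 T00 TP] := scaled_log_prob_bounds e0.
near=> T; have [|r /= -> //] := TP T.
by near: T; apply: nbhs_pinfty_ge; exact: num_real.
Unshelve. all: by end_near. Qed.

End Limits.

End Process.

(** * The large deviation limit *)

Theorem theorem2p1 (R : realType) (lambda : step -> R)
    (lambda_gt0 : forall y, y \in steps -> 0 < lambda y)
    (d : measure_display) (Omega : measurableType d) (P : probability Omega R)
    (xi : R -> Omega -> state) (xi_jump : markov_jump_process lambda P xi)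
    (f : trajectory R) (Ff : F_space f) :
  (forall eps : R, 0 < eps ->
     cvg (scaled_log_prob P xi f eps T @[T --> +oo])) /\
  lim (scaled_log_prob P xi f eps T @[T --> +oo]) @[eps --> 0^'+]
    --> (- rate_functional lambda f)%E.
Proof.
have [Z [tau [Z0 tau_gt0 tau_unbounded xiE law]]] := xi_jump.
have tube_cvg eps (eps_gt0 : 0 < eps) :=
  scaled_log_prob_cvg lambda_gt0 Z0 tau_gt0 tau_unbounded xiE law Ff eps_gt0.
split=> [eps eps_gt0|].
  by apply/cvg_ex; eexists; exact: tube_cvg.
rewrite (rate_functionalE lambda_gt0 Ff) -EFinN.
have limE eps : 0 < eps ->
    lim (scaled_log_prob P xi f eps T @[T --> +oo]) = (- tube_cost lambda f eps)%:E.
  by move=> eps_gt0; apply/cvg_lim => //; exact: tube_cvg.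
apply/fine_cvgP; split.
  near=> eps; rewrite limE//.
apply/cvgrPdist_le => e e0.
have cL0 := cost_lip_gt0 lambda_gt0.
near=> eps.
have eps_gt0 : 0 < eps by [].
rewrite /= limE//= opprK addrC.
have h1 := tube_cost_le_cost lambda_gt0 Ff eps_gt0.
have h2 := tube_cost_ge_cost lambda_gt0 Ff eps_gt0.
have h3 : cost_lip lambda * eps <= e.
  rewrite mulrC -ler_pdivlMr//; near: eps; apply: nbhs_right_le.
  by rewrite divr_gt0.
by rewrite ler_distlC; apply/andP; split; lra.
Unshelve. all: by end_near. Qed.
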